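(* There is a special $\Pi^0_1$ class $\mathcal P\subseteq 2^{\mathbb N}$ such that $\mathcal P\subseteq\mathrm{GL}_1$, $\mathcal P$ has the Join Property, and $\mathcal P$ does not have the Pseudojump Inversion Property. More strongly, the Join Property holds locally on $\mathcal P$: for every finite binary string $\sigma$ such that $\mathcal P\cap[\sigma]\neq\varnothing$, the class $\mathcal P\cap[\sigma]$ has the Join Property.
   Context: Reals are elements of Cantor space $2^{\mathbb N}$, identified with subsets of $\mathbb N=\{0,1,2,\dots\}$. $\leq_{\mathrm T},\equiv_{\mathrm T}$ denote Turing reducibility and equivalence; $Z>_{\mathrm T}0$ means that $Z$ is noncomputable. $(\Phi_e)_{e\in\mathbb N}$ is a standard effective enumeration of oracle Turing machines and $(W_e^X)_{e\in\mathbb N}$ a standard effective enumeration of the sets c.e. in $X$. The join is $(X\oplus Y)(2n)=X(n)$, $(X\oplus Y)(2n+1)=Y(n)$; the Turing jump is $X'=\{e:\Phi_e^X(e)\downarrow\}$, and $0'=\varnothing'$. For a finite binary string $\sigma$, $[\sigma]$ is the set of reals with initial segment $\sigma$. A $\Pi^0_1$ class is the complement in $2^{\mathbb N}$ of a union of a computably enumerable family of cylinders $[\sigma]$; it is special if it is nonempty and has no computable member. $\mathrm{GL}_1=\{X\in 2^{\mathbb N}:X'\equiv_{\mathrm T}X\oplus 0'\}$. The pseudojump operators are $J_e(X)=X\oplus W_e^X$, $e\in\mathbb N$. A class $\mathcal C\subseteq 2^{\mathbb N}$ has the Join Property if for all reals $A,Z$ with $Z\oplus 0'\leq_{\mathrm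 T}A$ and $Z>_{\mathrm T}0$ there is $B\in\mathcal C$ with $A\equiv_{\mathrm T}B'\equiv_{\mathrm T}B\oplus 0'\equiv_{\mathrm T}B\oplus Z$. It has the Pseudojump Inversion Property if for every real $A$ with $0'\leq_{\mathrm T}A$ and every $e\in\mathbb N$ there is $B\in\mathcal C$ with $A\equiv_{\mathrm T}J_e(B)\equiv_{\mathrm T}B\oplus 0'$. *)

(* Defs.v *)
From Stdlib Require Cantor.
From mathcomp Require Import all_boot boolp classical_sets.

Set Implicit Arguments.
Unset Strict Implicit.
Unset Printing Implicit Defensive.

Local Open Scope classical_set_scope.

(* The points of Cantor space; no topology is needed, since Pi^0_1 classes are
   given through their effective presentations. *)
Definition real : Type := nat -> bool.

Definition real_of_set (S : set nat) : real := fun n => `[< S n >].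

Definition pair_nat (x y : nat) : nat := Cantor.to_nat (x, y).

(* Programs for the partial functions nat -> nat that are recursive in an
   oracle; several arguments are packed into one by the Cantor pairing. *)
Inductive code : Type :=
  | Zero | Succ | Fst | Snd | Oracle
  | Pair of code & code
  | Comp of code & code
  | Prec of code & code
  | Mu of code.

(* [eval X c x y]: with oracle X, the program c halts on input x with output y.
   Comp, Prec and Mu are strict: every subcomputation needed must halt. *)
Fixpoint eval (X : real) (c : code) (x y : nat) : Prop :=
  match c with
  | Zero => y = 0
  | Succ => y = x.+1
  | Fst => y = (Cantor.of_nat x).1
  | Snd => y = (Cantor.of_nat x).2
  | Oracle => y = X x
  | Pair f g => exists u v, [/\ eval X f x u, eval X g x v & y = pair_nat u v]
  | Comp f g => exists u, eval X g x u /\ eval X f u y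
  | Prec f g =>
      let: (a, n) := Cantor.of_nat x in
      nat_rect (fun _ => nat -> Prop)
        (eval X f a)
        (fun k value_at_k z => exists u,
           value_at_k u /\ eval X g (pair_nat a (pair_nat k u)) z)
        n y
  | Mu f =>
      eval X f (pair_nat x y) 0 /\
      forall m, m < y -> exists u, eval X f (pair_nat x m) u.+1
  end.

(* Goedel numbering: the five basic programs get the numbers 0, ..., 4 and the
   numbers from 5 on are divided among the four constructors by their residue
   modulo 4. The first argument of [decode_fuel] only bounds the recursion. *)
Fixpoint decode_fuel (k n : nat) : code :=
  if k isn't k'.+1 then Zero else
  match n with
  | 0 => Zero
  | 1 => Succ
  | 2 => Fst
  | 3 => Snd
  | 4 => Oracle
  | m.+4.+1 =>
      let q := m %/ 4 in
      let: (a, b) := Cantor.of_nat q in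
      match m %% 4 with
      | 0 => Pair (decode_fuel k' a) (decode_fuel k' b)
      | 1 => Comp (decode_fuel k' a) (decode_fuel k' b)
      | 2 => Prec (decode_fuel k' a) (decode_fuel k' b)
      | _ => Mu (decode_fuel k' q)
      end
  end.

Definition decode (n : nat) : code := decode_fuel n.+1 n.

Fixpoint encode (c : code) : nat :=
  match c with
  | Zero => 0
  | Succ => 1
  | Fst => 2
  | Snd => 3
  | Oracle => 4
  | Pair f g => 5 + 4 * pair_nat (encode f) (encode g)
  | Comp f g => 5 + (4 * pair_nat (encode f) (encode g) + 1)
  | Prec f g => 5 + (4 * pair_nat (encode f) (encode g) + 2)
  | Mu f => 5 + (4 * encode f + 3)
  end.

Lemma leq_pair_nat x y : (x <= pair_nat x y) && (y <= pair_nat x y).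
Proof.
have /leP := Cantor.to_nat_non_decreasing x y.
rewrite -/(pair_nat x y) plusE => h; apply/andP; split.
  exact: leq_trans (leq_addl y x) h.
exact: leq_trans (leq_addr x y) h.
Qed.

Lemma decode_fuelK k c : encode c < k -> decode_fuel k (encode c) = c.
Proof.
have small q r : q <= 5 + (4 * q + r).
  by apply: leq_trans (leq_addl 5 _); apply: leq_trans (leq_addr r _); rewrite leq_pmull.
have divq q r : r < 4 -> (4 * q + r) %/ 4 = q.
  by move=> r4; rewrite mulnC divnMDl // divn_small // addn0.
have modq q r : r < 4 -> (4 * q + r) %% 4 = r.
  by move=> r4; rewrite mulnC modnMDl modn_small.
have lt_arg q r j : 5 + (4 * q + r) < j.+1 -> q < j.
  rewrite ltnS; apply: leq_trans; rewrite !addSn add0n ltnS.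
  by apply: leq_trans (leq_addl 4 _); apply: leq_trans (leq_addr r _); rewrite leq_pmull.
have of_pair u v : Cantor.of_nat (pair_nat u v) = (u, v).
  exact: Cantor.cancel_of_to.
elim: c k => [||||| f IHf g IHg | f IHf g IHg | f IHf g IHg | f IHf] [|k] //.
- rewrite [encode _]/= -[X in 5 + X]addn0 => /lt_arg lt_k.
  have /andP[le1 le2] := leq_pair_nat (encode f) (encode g).
  rewrite [5 + _]/= /= divq // modq // of_pair.
  by rewrite IHf ?IHg //; apply: leq_ltn_trans lt_k.
- rewrite [encode _]/= => /lt_arg lt_k.
  have /andP[le1 le2] := leq_pair_nat (encode f) (encode g).
  rewrite /= divq // modq // of_pair.
  by rewrite IHf ?IHg //; apply: leq_ltn_trans lt_k.
- rewrite [encode _]/= => /lt_arg lt_k.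
  have /andP[le1 le2] := leq_pair_nat (encode f) (encode g).
  rewrite /= divq // modq // of_pair.
  by rewrite IHf ?IHg //; apply: leq_ltn_trans lt_k.
- rewrite [encode _]/= => /lt_arg lt_k.
  by rewrite /= divq // modq //; case: Cantor.of_nat => _ _; rewrite IHf.
Qed.

Lemma encodeK : cancel encode decode.
Proof. by move=> c; apply: decode_fuelK. Qed.

Lemma eval_functional X c x y z : eval X c x y -> eval X c x z -> y = z.
Proof.
elim: c x y z => [||||| f IHf g IHg | f IHf g IHg | f IHf g IHg | f IHf] x y z /=;
  try by move=> -> ->.
- move=> [u [v [fu gv ->]]] [u' [v' [fu' gv' ->]]].
  by rewrite (IHf _ _ _ fu fu') (IHg _ _ _ gv gv').
- by move=> [u [gu fy]] [u' [/(IHg _ _ _ gu) <-]]; apply: IHf.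
- case: Cantor.of_nat => a n; elim: n y z => [|n IHn] y z /=; first exact: IHf.
  by move=> [u [hu gy]] [u' [/(IHn _ _ hu) <-]]; apply: IHg.
- move=> [fy0 fy] [fz0 fz]; case: (ltngtP y z) => // lt.
    by have [u fu] := fz _ lt; have := IHf _ _ _ fy0 fu.
  by have [u fu] := fy _ lt; have := IHf _ _ _ fz0 fu.
Qed.

Definition Phi (e : nat) (X : real) (x y : nat) : Prop := eval X (decode e) x y.

Definition W (e : nat) (X : real) : set nat := [set x | exists y, Phi e X x y].

Definition turing_le (A B : real) : Prop :=
  exists e, forall n, Phi e B n (A n).

Definition turing_equiv (A B : real) : Prop := turing_le A B /\ turing_le B A.

Declare Scope turing_scope.
Notation "A <=T B" := (turing_le A B) (at level 70) : turing_scope.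
Notation "A =T B" := (turing_equiv A B) (at level 70) : turing_scope.
Local Open Scope turing_scope.

Definition empty_real : real := fun=> false.

Definition computable (X : real) : Prop := X <=T empty_real.

Definition join (X Y : real) : real :=
  fun n => if odd n then Y n./2 else X n./2.

Definition jump (X : real) : real :=
  real_of_set [set e | exists y, Phi e X e y].

Definition zero_jump : real := jump empty_real.

Definition pseudojump (e : nat) (X : real) : real :=
  join X (real_of_set (W e X)).

Definition cylinder (s : seq bool) : set real :=
  [set X | mkseq X (size s) = s].

(* Bijective base-2 numeration, least significant digit first. *)
Definition string_code (s : seq bool) : nat :=
  foldr (fun (b : bool) n => (n.*2 + b).+1) 0 s.

Definition ce_strings (S : set (seq bool)) : Prop :=
  exists e, S = [set s | W e empty_real (string_code s)].

Definition Pi01_class (P : set real) : Prop :=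
  exists S, ce_strings S /\ P = ~` \bigcup_(s in S) cylinder s.

Definition special (P : set real) : Prop :=
  P !=set0 /\ forall X, P X -> ~ computable X.

Definition GL1 : set real := [set X | jump X =T join X zero_jump].

Definition join_property (C : set real) : Prop :=
  forall A Z : real, join Z zero_jump <=T A -> ~ computable Z ->
  exists B, C B /\
    [/\ A =T jump B, jump B =T join B zero_jump
      & join B zero_jump =T join B Z].

Definition pseudojump_inversion_property (C : set real) : Prop :=
  forall (A : real) (e : nat), zero_jump <=T A ->
  exists B, C B /\
    A =T pseudojump e B /\ pseudojump e B =T join B zero_jump.

(* Main.v *)
Require Import Defs.
From Stdlib Require Cantor.
From mathcomp Require Import all_boot boolp classical_sets zify.

(** The class consists of the joins of d and c, where d runs through a Pi01
    class D and c through a Pi01 class C(d) that is computed from d.  Both come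
    from one construction, [tree_class], relative to an oracle d and to a rule
    which attaches a jump requirement to some of the binary strings.  Stage s of
    the construction has an order embedding u |-> [node d s u] of the binary
    strings into themselves; at first it is the identity.  If the rule attaches
    requirement e to u, if the string now at u does not make program e halt on
    input e (with oracle d joined to that string), and if the string at some
    extension v of u does, then everything above v is moved down to u.  Once
    the proper prefixes of u are at rest u moves at most once, so every u is
    finally settled ([settles]).  The class of reals that run through the image
    at all stages is Pi01 in d; along a member X, the settled string at u
    decides whether e belongs to the jump of the join of d and X
    ([jump_decided]), because otherwise u would still have to move.

    Tree D uses the empty oracle and attaches requirement e to all strings of
    length e+1 ([level_rule]).  The jump can then be decided along every member, so D lies
    inside GL1 ([level_GL1]); more strongly, every Sigma01 property of reals is
    constant on D near each member of D ([level_generic]).  As D has no isolated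
    members, none of its members is computable: to differ from a computable real
    is Sigma01.

    Tree C(d) attaches requirements only to strings that end in a one
    ([block_rule]), the k-th one being responsible for requirement k-1.  A path
    with infinitely many ones decides the jump as before; a path that ends in
    zeros is computable from d.  In both cases the jump of the join of d and c
    reduces to c joined with the jump of d, hence, as d is in GL1, to the join
    of d and c with the halting problem ([tree_pair_GL1]).

    Pseudojump inversion fails for a trivial operator: if W_e is always empty,
    then J_e(B) has the degree of B, and inverting the halting problem would
    require a B which computes B joined with the halting problem, that is, its
    own jump ([tree_pair_not_inversion]).

    For the Join Property let A compute Z and the halting problem, Z being
    noncomputable, and fix a member of the class in the given cylinder.
    [cone_avoidance] replaces its left half by a nearby d in D that is computable
    from A and does not compute Z; by [level_generic] the node of C(d) through
    which the right half runs can be kept.  Then [posner_robinson] builds c in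
    C(d) from blocks of zeros closed by a one.  Let u be the node reached before
    block k, settled at stage s, and consider for each n the event that
    u 0...0 1, with n zeros, moves after stage s.  It is c.e. in d, while Z or
    its complement is not, so among the n of parity A(k) there is one where
    Z(n/2) and the occurrence of the event disagree.  That n is used.  From c and
    d one reads n off; then Z, and likewise the jump of d, tells whether to wait
    for the move, and so gives the stage from which the next block can be read.
    Hence c, d and Z together compute A, and so does the jump of the join of c
    and d ([decode_history]).

    To make these constructions computations in the sense of [eval], operators
    on coded types are shown to be [effective] by closure properties, a
    universal machine is obtained from decidable checking of finite derivations
    ([universal_machine]), and recursive constructions are done by an effective
    form of dependent choice ([eff_dep_choice]). *)

Set Implicit Arguments.
Unset Strict Implicit.
Unset Printing Implicit Defensive.

Local Open Scope classical_set_scope.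
Local Open Scope turing_scope.

(** * Effective operators on coded types *)

Arguments pair_nat : simpl never.
Arguments Cantor.of_nat : simpl never.

Class coded (T : Type) := num : T -> nat.

#[global] Instance coded_nat : coded nat := id.
#[global] Instance coded_bool : coded bool := nat_of_bool.
#[global] Instance coded_prod A B (cA : coded A) (cB : coded B) :
  coded (A * B) := fun p => pair_nat (num p.1) (num p.2).
#[global] Instance coded_seq A (cA : coded A) : coded (seq A) :=
  foldr (fun x n => (pair_nat (num x) n).+1) 0.

(** One program has to work for all oracles in D: for D = setT this is
    uniform computability relative to an oracle, for D = [set Y] it is
    computability from Y. *)
Definition effective (D : set real) {A B : Type} {cA : coded A} {cB : coded B}
    (f : real -> A -> B) : Prop :=
  exists c, forall X, D X -> forall a, eval X c (num a) (num (f X a)).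

Definition idc := Pair Fst Snd.

Lemma of_pair_nat x y : Cantor.of_nat (pair_nat x y) = (x, y).
Proof. exact: Cantor.cancel_of_to. Qed.

Lemma pair_of_nat n :
  pair_nat (Cantor.of_nat n).1 (Cantor.of_nat n).2 = n.
Proof. by rewrite /pair_nat -surjective_pairing Cantor.cancel_to_of. Qed.

Lemma eval_idc X x : eval X idc x x.
Proof. by do 2!eexists; split=> //=; rewrite pair_of_nat. Qed.

Fixpoint constc (n : nat) : code :=
  if n is m.+1 then Comp Succ (constc m) else Zero.

Lemma eval_constc X n x : eval X (constc n) x n.
Proof. by elim: n => [|n IHn] //=; exists n. Qed.

Lemma eval_prec X f g a n y :
  eval X (Prec f g) (pair_nat a n) y =
  nat_rect (fun _ => nat -> Prop) (eval X f a)
    (fun k value_at_k z => exists u,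
       value_at_k u /\ eval X g (pair_nat a (pair_nat k u)) z) n y.
Proof. by rewrite /= of_pair_nat. Qed.

Section Combinators.
Variable D : set real.
Context {A : Type} {cA : coded A}.
Implicit Type a : A.

Lemma eff_id : effective D (fun (_ : real) a => a).
Proof. by exists idc => *; apply: eval_idc. Qed.

Lemma eff_cst B {cB : coded B} (b : B) : effective D (fun (_ : real) a => b).
Proof. by exists (constc (num b)) => *; apply: eval_constc. Qed.

Lemma eff_comp B {cB : coded B} C {cC : coded C}
    (f : real -> B -> C) (g : real -> A -> B) :
  effective D f -> effective D g -> effective D (fun X a => f X (g X a)).
Proof.
move=> [cf hf] [cg hg]; exists (Comp cf cg) => X DX a.
by exists (num (g X a)); split; [apply: hg|apply: hf].
Qed.

Lemma eff_pair B {cB : coded B} C {cC : coded C}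
    (f : real -> A -> B) (g : real -> A -> C) :
  effective D f -> effective D g -> effective D (fun X a => (f X a, g X a)).
Proof.
move=> [cf hf] [cg hg]; exists (Pair cf cg) => X DX a.
by exists (num (f X a)), (num (g X a)); split; [apply: hf|apply: hg|].
Qed.

Lemma eff_fst B {cB : coded B} C {cC : coded C} (f : real -> A -> B * C) :
  effective D f -> effective D (fun X a => (f X a).1).
Proof.
move=> [cf hf]; exists (Comp Fst cf) => X DX a; exists (num (f X a)).
by split; [apply: hf|rewrite /= of_pair_nat].
Qed.

Lemma eff_snd B {cB : coded B} C {cC : coded C} (f : real -> A -> B * C) :
  effective D f -> effective D (fun X a => (f X a).2).
Proof.
move=> [cf hf]; exists (Comp Snd cf) => X DX a; exists (num (f X a)).
by split; [apply: hf|rewrite /= of_pair_nat].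
Qed.

Lemma eff_pair_nat (f g : real -> A -> nat) :
  effective D f -> effective D g ->
  effective D (fun X a => pair_nat (f X a) (g X a)).
Proof.
move=> [cf hf] [cg hg]; exists (Pair cf cg) => X DX a.
by exists (f X a), (g X a); split; [apply: hf|apply: hg|].
Qed.

Lemma eff_of_nat (f : real -> A -> nat) :
  effective D f -> effective D (fun X a => Cantor.of_nat (f X a)).
Proof.
move=> [cf hf]; exists cf => X DX a; have := hf _ DX a.
by rewrite /num/= /coded_prod/= /num /coded_nat pair_of_nat.
Qed.

Lemma eff_succ (f : real -> A -> nat) :
  effective D f -> effective D (fun X a => (f X a).+1).
Proof.
move=> [cf hf]; exists (Comp Succ cf) => X DX a; exists (f X a).
by split; [apply: hf|].
Qed.

Lemma eff_oracle (f : real -> A -> nat) :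
  effective D f -> effective D (fun X a => X (f X a)).
Proof.
move=> [cf hf]; exists (Comp Oracle cf) => X DX a; exists (f X a).
by split; [apply: hf|].
Qed.

Lemma eff_nat_rect B {cB : coded B} (z : real -> A -> B)
    (s : real -> A -> nat -> B -> B) (n : real -> A -> nat) :
  effective D z ->
  effective D (fun X (p : A * nat * B) => s X p.1.1 p.1.2 p.2) ->
  effective D n ->
  effective D (fun X a => nat_rect (fun _ => B) (z X a) (s X a) (n X a)).
Proof.
move=> [cz hz] [cs hs] [cn hn].
(* the step receives (a, (k, u)) and has to be fed ((a, k), u) *)
pose shuffle := Pair (Pair Fst (Comp Fst Snd)) (Comp Snd Snd).
exists (Comp (Prec cz (Comp cs shuffle)) (Pair idc cn)) => X DX a.
exists (pair_nat (num a) (n X a)); split.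
  by exists (num a), (n X a); split; [apply: eval_idc|apply: hn|].
rewrite /= of_pair_nat; elim: (n X a) => [|k IHk] /=; first exact: hz.
exists (num (nat_rect (fun _ => B) (z X a) (s X a) k)); split=> //.
set u := nat_rect _ _ _ _.
exists (num ((a, k), u)); split; last exact: (hs _ DX ((a, k), u)).
rewrite /=; exists (pair_nat (num a) k), (num u); rewrite of_pair_nat /=; split=> //.
  exists (num a), k; split=> //.
  by exists (pair_nat k (num u)); rewrite of_pair_nat.
by exists (pair_nat k (num u)); rewrite of_pair_nat.
Qed.

Lemma eff_if B {cB : coded B} (b : real -> A -> bool) (f g : real -> A -> B) :
  effective D b -> effective D f -> effective D g ->
  effective D (fun X a => if b X a then f X a else g X a).
Proof.
move=> [cb hb] [cf hf] [cg hg].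
exists (Comp (Prec cg (Comp cf Fst)) (Pair idc cb)) => X DX a.
exists (pair_nat (num a) (num (b X a))); split.
  by exists (num a), (num (b X a)); split; [apply: eval_idc|apply: hb|].
rewrite /= of_pair_nat; case: (b X a) => /=; last exact: hg.
exists (num (g X a)); split; first exact: hg.
by exists (num a); rewrite of_pair_nat; split => //; apply: hf.
Qed.

Lemma eff_ext B {cB : coded B} (f g : real -> A -> B) :
  (forall X a, f X a = g X a) -> effective D f -> effective D g.
Proof. by move=> fg [c hc]; exists c => X DX a; rewrite -fg; apply: hc. Qed.

End Combinators.

(** The closure lemmas are collected in a hint database that is searched
    syntactically: a goal is decomposed along the head symbols of the operator. *)
Create HintDb eff discriminated.
#[global] Hint Constants Opaque : eff.
#[global] Hint Variables Opaque : eff.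
#[global] Hint Resolve eff_id eff_cst eff_pair eff_fst eff_snd eff_pair_nat eff_of_nat
  eff_succ eff_oracle eff_if eff_nat_rect : eff.

(* A variable applied to a compound argument has no head symbol to go by: the
   composition is made explicit. *)
#[global] Hint Extern 5 (effective ?D ?F) =>
  match F with
  | (fun X p => ?f X (@?g X p)) => is_var f; apply: (@eff_comp D _ _ _ _ _ _ f g)
  | (fun X p => ?f (@?g X p)) => is_var f; apply: (@eff_comp D _ _ _ _ _ _ (fun _ => f) g)
  | (fun X p => ?f (@?g X p)) =>
      match goal with H : effective D (fun _ => f) |- _ => apply: (eff_comp H) end
  end : eff.

Ltac eff := typeclasses eauto 200 with eff.

Lemma eff_pred (D : set real) A {cA : coded A} (f : real -> A -> nat) : effective D f ->
    effective D (fun X a => (f X a).-1).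
Proof.
move=> hf.
apply: (@eff_ext D A _ nat _ (fun X a => nat_rect (fun _ => nat) 0 (fun k _ => k) (f X a))).
  by move=> X a; case: (f X a).
eff.
Qed.

Lemma eff_add (D : set real) A {cA : coded A} (f g : real -> A -> nat) : effective D f ->
    effective D g ->
  effective D (fun X a => f X a + g X a).
Proof.
move=> hf hg.
apply: (@eff_ext D A _ nat _
  (fun X a => nat_rect (fun _ => nat) (g X a) (fun _ n => n.+1) (f X a))).
  by move=> X a; elim: (f X a) => //= n ->.
eff.
Qed.

Lemma eff_sub (D : set real) A {cA : coded A} (f g : real -> A -> nat) : effective D f ->
    effective D g ->
  effective D (fun X a => f X a - g X a).
Proof.
move=> hf hg; apply: (@eff_ext D A _ nat _
  (fun X a => nat_rect (fun _ => nat) (f X a) (fun _ n => n.-1) (g X a))).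
  by move=> X a; elim: (g X a) => [|n /= ->]; rewrite ?subn0 ?subnS.
by apply: eff_nat_rect => //; apply: eff_pred; eff.
Qed.

Lemma eff_mul (D : set real) A {cA : coded A} (f g : real -> A -> nat) : effective D f ->
    effective D g ->
  effective D (fun X a => f X a * g X a).
Proof.
move=> hf hg; apply: (@eff_ext D A _ nat _
  (fun X a => nat_rect (fun _ => nat) 0 (fun _ n => g X a + n) (f X a))).
  by move=> X a; elim: (f X a) => [|n /= ->]; rewrite ?mulSn.
apply: eff_nat_rect => //; first by eff.
by apply: eff_add; [apply: eff_comp; eff|eff].
Qed.

Lemma eff_is0 (D : set real) A {cA : coded A} (f : real -> A -> nat) : effective D f ->
    effective D (fun X a => f X a == 0).
Proof.
move=> hf; apply: (@eff_ext D A _ bool _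
  (fun X a => nat_rect (fun _ => bool) true (fun _ _ => false) (f X a))).
  by move=> X a; case: (f X a).
by eff.
Qed.

Lemma eff_negb (D : set real) A {cA : coded A} (p : real -> A -> bool) : effective D p ->
    effective D (fun X a => ~~ p X a).
Proof.
move=> hp; apply: (@eff_ext D A _ bool _ (fun X a => if p X a then false else true)).
  by move=> X a; case: (p X a).
by eff.
Qed.

Lemma eff_andb (D : set real) A {cA : coded A} (p q : real -> A -> bool) : effective D p ->
    effective D q ->
  effective D (fun X a => p X a && q X a).
Proof.
move=> hp hq; apply: (@eff_ext D A _ bool _ (fun X a => if p X a then q X a else false)).
  by move=> X a; case: (p X a).
by eff.
Qed.

Lemma eff_orb (D : set real) A {cA : coded A} (p q : real -> A -> bool) : effective D p ->
    effective D q ->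
  effective D (fun X a => p X a || q X a).
Proof.
move=> hp hq; apply: (@eff_ext D A _ bool _ (fun X a => if p X a then true else q X a)).
  by move=> X a; case: (p X a).
by eff.
Qed.

Lemma eff_eqb (D : set real) A {cA : coded A} (p q : real -> A -> bool) : effective D p ->
    effective D q ->
  effective D (fun X a => p X a == q X a).
Proof.
move=> hp hq; apply: (@eff_ext D A _ bool _
    (fun X a => if p X a then q X a else ~~ q X a)).
  by move=> X a; case: (p X a); case: (q X a).
by apply: eff_if => //; apply: eff_negb.
Qed.

Lemma eff_leq (D : set real) A {cA : coded A} (f g : real -> A -> nat) : effective D f ->
    effective D g ->
  effective D (fun X a => f X a <= g X a).
Proof. by move=> hf hg; apply: eff_is0; apply: eff_sub. Qed.

Lemma eff_eqn (D : set real) A {cA : coded A} (f g : real -> A -> nat) : effective D f ->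
    effective D g ->
  effective D (fun X a => f X a == g X a).
Proof.
move=> hf hg; apply: (@eff_ext D A _ bool _
    (fun X a => (f X a <= g X a) && (g X a <= f X a))).
  by move=> X a; rewrite -eqn_leq.
by apply: eff_andb; apply: eff_leq.
Qed.

Lemma eff_odd (D : set real) A {cA : coded A} (f : real -> A -> nat) : effective D f ->
    effective D (fun X a => odd (f X a)).
Proof.
move=> hf; apply: (@eff_ext D A _ bool _
  (fun X a => nat_rect (fun _ => bool) false (fun _ b => if b then false else true) (f X a))).
  by move=> X a; elim: (f X a) => //= n ->; case: odd.
by eff.
Qed.

Lemma eff_half (D : set real) A {cA : coded A} (f : real -> A -> nat) : effective D f ->
    effective D (fun X a => (f X a)./2).
Proof.
move=> hf; apply: (@eff_ext D A _ nat _
  (fun X a => (nat_rect (fun _ => nat * nat)%type (0, 0)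
     (fun _ p => (p.2, p.1.+1)) (f X a)).1)).
  move=> X a; set s := nat_rect _ _ _.
  suff -> : s (f X a) = ((f X a)./2, uphalf (f X a)) by [].
  by elim: (f X a) => // n IHn; rewrite /s /= -/(s n) IHn.
by eff.
Qed.

Lemma eff_double (D : set real) A {cA : coded A} (f : real -> A -> nat) : effective D f ->
    effective D (fun X a => (f X a).*2).
Proof.
move=> hf; apply: (@eff_ext D A _ nat _ (fun X a => f X a + f X a)).
  by move=> X a; rewrite addnn.
exact: eff_add.
Qed.

Lemma eff_nat_of_bool (D : set real) A {cA : coded A} (p : real -> A -> bool) :
    effective D p -> effective D (fun X a => nat_of_bool (p X a)).
Proof. by case=> c hc; exists c. Qed.

Lemma eff_num (D : set real) A {cA : coded A} B {cB : coded B} (f : real -> A -> B) :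
  effective D f -> effective D (fun X a => num (f X a)).
Proof. by case=> c hc; exists c. Qed.

#[global] Hint Resolve eff_pred eff_add eff_sub eff_mul eff_is0 eff_negb eff_andb
  eff_orb eff_eqb eff_leq eff_eqn eff_odd eff_half eff_double eff_nat_of_bool : eff.

Lemma eff_cons (D : set real) A {cA : coded A} T {cT : coded T} (x : real -> A -> T) (l :
    real -> A -> seq T) : effective D x -> effective D l ->
  effective D (fun X a => x X a :: l X a).
Proof.
move=> hx hl; have [c hc] : effective D (fun X a => (pair_nat (num (x X a)) (num (l X a))).+1).
  by apply: eff_succ; apply: eff_pair_nat; apply: eff_num.
by exists c.
Qed.

Lemma eff_list_case (D : set real) A {cA : coded A} T {cT : coded T} B {cB : coded B} (l :
    real -> A -> seq T) (f : real -> A -> B) (g : real -> A -> T -> seq T -> B) :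
  effective D l -> effective D f ->
  effective D (fun X (p : A * (T * seq T)) => g X p.1 p.2.1 p.2.2) ->
  effective D (fun X a => match l X a with [::] => f X a | x :: s => g X a x s end).
Proof.
move=> hl [cf hf] [cg hg].
have [cb hb] : effective D (fun X a => ~~ (num (l X a) == 0)).
  by apply: eff_negb; apply: eff_is0; apply: eff_num.
have [ct ht] : effective D (fun X a => (num (l X a)).-1).
  by apply: eff_pred; apply: eff_num.
(* Prec on the bit that tells whether the list is empty: the second branch
   only runs when there is a head to hand over *)
exists (Comp (Prec cf (Comp cg (Comp (Pair idc ct) Fst))) (Pair idc cb)) => X DX a.
move: (hb _ DX a) (ht _ DX a); case: (l X a) => [|x s] hba hta.
  exists (pair_nat (num a) 0); split.
    by exists (num a), 0; split; [apply: eval_idc|apply: hba|].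
  by rewrite eval_prec; apply: hf.
exists (pair_nat (num a) 1); split.
  by exists (num a), 1; split; [apply: eval_idc|apply: hba|].
rewrite eval_prec /=; exists (num (f X a)); split; first exact: hf.
exists (num (a, (x, s))); split; last exact: (hg _ DX (a, (x, s))).
exists (num a); split; first by rewrite /= of_pair_nat.
exists (num a), (num (x, s)); split=> //; exact: eval_idc.
Qed.

Lemma size_num T {cT : coded T} (s : seq T) : size s <= num s.
Proof.
elim: s => //= x s IHs; rewrite /num /= ltnS.
by apply: leq_trans IHs _; case/andP: (leq_pair_nat (cT x) (coded_seq cT s)).
Qed.

(** Primitive recursion on the code of the list, which bounds its length;
    rounds after the list is exhausted change nothing. *)
Lemma eff_foldl (D : set real) A {cA : coded A} T {cT : coded T} B {cB : coded B} (f : real ->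
    A -> B -> T -> B) (z : real -> A -> B) (l : real -> A -> seq T) :
  effective D (fun X (p : A * B * T) => f X p.1.1 p.1.2 p.2) ->
  effective D z -> effective D l ->
  effective D (fun X a => foldl (f X a) (z X a) (l X a)).
Proof.
move=> hf hz hl.
pose step X a (p : B * seq T) : B * seq T :=
  match p.2 with [::] => p | x :: s => (f X a p.1 x, s) end.
apply: (@eff_ext D A _ B _ (fun X a => (nat_rect (fun _ => (B * seq T)%type)
    (z X a, l X a) (fun _ p => step X a p) (num (l X a))).1)).
  move=> X a; move: (@size_num T cT (l X a)); move: (num _) => n.
  suff H : forall b s, size s <= n -> (nat_rect (fun _ => (B * seq T)%type)
       (b, s) (fun _ p => step X a p) n) = (foldl (f X a) b s, [::]).
    by move=> /H ->.
  have iterS k b s : nat_rect (fun _ => (B * seq T)%type) (b, s) (fun _ p => step X a p) k.+1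
    = nat_rect (fun _ => (B * seq T)%type) (step X a (b, s)) (fun _ p => step X a p) k.
    by elim: k => //= k ->.
  elim: n => [|n IHn] b [|x s] // hs; rewrite iterS /step /= IHn //.
apply: eff_fst; apply: eff_nat_rect; [eff| |exact: eff_num].
apply: (eff_list_case (l := fun X p => p.2.2) (f := fun X p => p.2)
  (g := fun X p x s => (f X p.1.1 p.2.1 x, s))); [eff|eff|].
apply: eff_pair; last by eff.
by apply: (eff_comp (f := fun X p => f X p.1.1 p.1.2 p.2)
   (g := fun X (q : A * nat * (B * seq T) * (T * seq T)) => (q.1.1.1, q.1.2.1, q.2.1))) => //; eff.
Qed.

#[global] Hint Resolve eff_cons eff_foldl : eff.

(** * Lists and strings *)

Lemma eff_rev (D : set real) A {cA : coded A} T {cT : coded T} (l : real -> A -> seq T) :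
  effective D l -> effective D (fun X a => rev (l X a)).
Proof.
move=> hl; apply: (@eff_ext D A _ (seq T) _ (fun X a => foldl (fun s x => x :: s) [::] (l X a))).
  by move=> X a; rewrite /rev; elim: (l X a) [::] => //= x s IHs u; apply: IHs.
by eff.
Qed.
#[global] Hint Resolve eff_rev : eff.

Lemma eff_foldr (D : set real) A {cA : coded A} T {cT : coded T} B {cB : coded B}
    (f : real -> A -> T -> B -> B) (z : real -> A -> B) (l : real -> A -> seq T) :
  effective D (fun X (p : A * B * T) => f X p.1.1 p.2 p.1.2) ->
  effective D z -> effective D l ->
  effective D (fun X a => foldr (f X a) (z X a) (l X a)).
Proof.
move=> hf hz hl; apply: (@eff_ext D A _ B _
  (fun X a => foldl (fun b x => f X a x b) (z X a) (rev (l X a)))).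
  by move=> X a; rewrite foldl_rev.
by eff.
Qed.
#[global] Hint Resolve eff_foldr : eff.

Lemma eff_cat (D : set real) A {cA : coded A} T {cT : coded T} (l m : real -> A -> seq T) :
  effective D l -> effective D m -> effective D (fun X a => l X a ++ m X a).
Proof.
move=> hl hm; apply: (@eff_ext D A _ (seq T) _ (fun X a => foldr cons (m X a) (l X a))).
  by move=> X a; elim: (l X a) => //= x s ->.
by eff.
Qed.
#[global] Hint Resolve eff_cat : eff.

Lemma eff_rcons (D : set real) A {cA : coded A} T {cT : coded T} (l : real -> A -> seq T)
    (x : real -> A -> T) :
  effective D l -> effective D x -> effective D (fun X a => rcons (l X a) (x X a)).
Proof.
move=> hl hx; apply: (@eff_ext D A _ (seq T) _ (fun X a => l X a ++ [:: x X a])).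
  by move=> X a; rewrite cats1.
by eff.
Qed.

Lemma eff_map (D : set real) A {cA : coded A} T {cT : coded T} B {cB : coded B}
    (f : real -> A -> T -> B) (l : real -> A -> seq T) :
  effective D (fun X (p : A * T) => f X p.1 p.2) -> effective D l ->
  effective D (fun X a => map (f X a) (l X a)).
Proof.
move=> hf hl; apply: (@eff_ext D A _ (seq B) _
  (fun X a => foldr (fun x s => f X a x :: s) [::] (l X a))).
  by move=> X a; elim: (l X a) => //= x s ->.
apply: eff_foldr => //; last by eff.
apply: eff_cons; last by eff.
by apply: (eff_comp (f := fun X p => f X p.1 p.2)
  (g := fun X (q : A * seq B * T) => (q.1.1, q.2))) => //; eff.
Qed.

Lemma eff_has (D : set real) A {cA : coded A} T {cT : coded T}
    (f : real -> A -> T -> bool) (l : real -> A -> seq T) :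
  effective D (fun X (p : A * T) => f X p.1 p.2) -> effective D l ->
  effective D (fun X a => has (f X a) (l X a)).
Proof.
move=> hf hl; apply: (@eff_ext D A _ bool _
  (fun X a => foldr (fun x b => f X a x || b) false (l X a))).
  by move=> X a; elim: (l X a) => //= x s ->.
apply: eff_foldr => //; last by eff.
apply: eff_orb; last by eff.
by apply: (eff_comp (f := fun X p => f X p.1 p.2)
  (g := fun X (q : A * bool * T) => (q.1.1, q.2))) => //; eff.
Qed.

Lemma eff_all (D : set real) A {cA : coded A} T {cT : coded T}
    (f : real -> A -> T -> bool) (l : real -> A -> seq T) :
  effective D (fun X (p : A * T) => f X p.1 p.2) -> effective D l ->
  effective D (fun X a => all (f X a) (l X a)).
Proof.
move=> hf hl; apply: (@eff_ext D A _ bool _ (fun X a => ~~ has (fun x => ~~ f X a x) (l X a))).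
  by move=> X a; rewrite has_predC negbK.
apply: eff_negb; apply: eff_has => //; exact: eff_negb.
Qed.

Lemma eff_size (D : set real) A {cA : coded A} T {cT : coded T} (l : real -> A -> seq T) :
  effective D l -> effective D (fun X a => size (l X a)).
Proof.
move=> hl; apply: (@eff_ext D A _ nat _ (fun X a => foldr (fun _ n => n.+1) 0 (l X a))).
  by move=> X a; elim: (l X a) => //= x s ->.
by eff.
Qed.

#[global] Hint Resolve eff_rcons eff_map eff_has eff_all eff_size : eff.

Lemma eff_drop (D : set real) A {cA : coded A} T {cT : coded T} (n : real -> A -> nat)
    (l : real -> A -> seq T) :
  effective D n -> effective D l -> effective D (fun X a => drop (n X a) (l X a)).
Proof.
move=> hn hl; apply: (@eff_ext D A _ (seq T) _ (fun X a => nat_rect (fun _ => seq T)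
    (l X a) (fun _ s => match s with [::] => [::] | _ :: s' => s' end) (n X a))).
  move=> X a; elim: (n X a) => [|k /= ->]; first by rewrite drop0.
  by rewrite -addn1 addnC -drop_drop; case: (drop k _) => //= x s; rewrite drop0.
apply: eff_nat_rect => //.
by apply: (eff_list_case (f := fun _ _ => [::]) (g := fun _ _ _ s => s)); eff.
Qed.

Lemma eff_nth (D : set real) A {cA : coded A} T {cT : coded T} (x0 : real -> A -> T)
    (l : real -> A -> seq T) (n : real -> A -> nat) :
  effective D x0 -> effective D l -> effective D n ->
  effective D (fun X a => nth (x0 X a) (l X a) (n X a)).
Proof.
move=> hx hl hn; apply: (@eff_ext D A _ T _ (fun X a =>
    match drop (n X a) (l X a) with [::] => x0 X a | x :: _ => x end)).
  by move=> X a; rewrite -[n X a in RHS]addn0 -nth_drop; case: drop.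
apply: (eff_list_case (f := x0) (g := fun _ _ x _ => x)) => //; last by eff.
exact: eff_drop.
Qed.

Lemma eff_iota (D : set real) A {cA : coded A} (n : real -> A -> nat) :
  effective D n -> effective D (fun X a => iota 0 (n X a)).
Proof.
move=> hn; apply: (@eff_ext D A _ (seq nat) _ (fun X a => nat_rect (fun _ => seq nat)
    [::] (fun k s => rcons s k) (n X a))).
  by move=> X a; elim: (n X a) => // k IHk; rewrite -addn1 iotaD cats1 addn1 /= IHk.
by eff.
Qed.
#[global] Hint Resolve eff_drop eff_nth eff_iota : eff.

Lemma eff_mkseq (D : set real) A {cA : coded A} T {cT : coded T}
    (f : real -> A -> nat -> T) (n : real -> A -> nat) :
  effective D (fun X (p : A * nat) => f X p.1 p.2) -> effective D n ->
  effective D (fun X a => mkseq (f X a) (n X a)).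
Proof. by move=> hf hn; apply: eff_map => //; eff. Qed.

Lemma eff_take (D : set real) A {cA : coded A} T {cT : coded T} (n : real -> A -> nat)
    (l : real -> A -> seq T) :
  effective D n -> effective D l -> effective D (fun X a => take (n X a) (l X a)).
Proof.
move=> hn hl; apply: (@eff_ext D A _ (seq T) _ (fun X a =>
    rev (drop (size (l X a) - n X a) (rev (l X a))))).
  by move=> X a; rewrite -[in RHS](revK (l X a)) take_rev size_rev.
by eff.
Qed.

Lemma eff_count (D : set real) A {cA : coded A} T {cT : coded T}
    (f : real -> A -> T -> bool) (l : real -> A -> seq T) :
  effective D (fun X (p : A * T) => f X p.1 p.2) -> effective D l ->
  effective D (fun X a => count (f X a) (l X a)).
Proof.
move=> hf hl; apply: (@eff_ext D A _ nat _
  (fun X a => foldr (fun x n => f X a x + n) 0 (l X a))).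
  by move=> X a; elim: (l X a) => //= x s ->.
apply: eff_foldr => //; last by eff.
apply: eff_add; last by eff.
apply: eff_nat_of_bool; by apply: (eff_comp (f := fun X p => f X p.1 p.2)
  (g := fun X (q : A * nat * T) => (q.1.1, q.2))) => //; eff.
Qed.

Lemma eff_last (D : set real) A {cA : coded A} T {cT : coded T} (x0 : real -> A -> T)
    (l : real -> A -> seq T) :
  effective D x0 -> effective D l -> effective D (fun X a => last (x0 X a) (l X a)).
Proof.
move=> hx hl; apply: (@eff_ext D A _ T _ (fun X a => foldl (fun _ x => x) (x0 X a) (l X a))).
  by move=> X a; elim: (l X a) (x0 X a) => //= x s ->.
by eff.
Qed.

#[global] Hint Resolve eff_mkseq eff_take eff_count eff_last : eff.

Lemma eff_prefix (D : set real) A {cA : coded A} (s t : real -> A -> seq bool) :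
  effective D s -> effective D t -> effective D (fun X a => prefix (s X a) (t X a)).
Proof.
move=> hs ht; apply: (@eff_ext D A _ bool _ (fun X a => (size (s X a) <= size (t X a)) &&
    all (fun i => nth false (s X a) i == nth false (t X a) i) (iota 0 (size (s X a))))).
  move=> X a; move: (s X a) (t X a) => u v; rewrite prefixE.
  apply/andP/eqP => [[le_uv /allP h]|h].
    apply: (@eq_from_nth _ false) => [|i]; rewrite size_takel // => lt_i.
    by rewrite nth_take //; apply/esym/eqP/h; rewrite mem_iota.
  split; first by rewrite -h size_take_min geq_minr.
  by apply/allP => i; rewrite mem_iota /= => lt_i; rewrite -[in nth _ u]h nth_take.
apply: eff_andb; first by eff.
apply: eff_all; last by eff.
by apply: eff_eqb; apply: eff_nth; [eff|apply: eff_comp; eff|eff|eff|apply: eff_comp; eff|eff].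
Qed.
#[global] Hint Resolve eff_prefix : eff.

(** * Oracle substitution and search *)

Fixpoint code_subst (q c : code) : code :=
  match c with
  | Oracle => q
  | Pair f g => Pair (code_subst q f) (code_subst q g)
  | Comp f g => Comp (code_subst q f) (code_subst q g)
  | Prec f g => Prec (code_subst q f) (code_subst q g)
  | Mu f => Mu (code_subst q f)
  | c => c
  end.

(** Relativization: an oracle that is itself computed can be replaced by its
    program. *)
Lemma eval_code_subst (X Y : real) q c x y : (forall n, eval X q n (Y n)) ->
  eval X (code_subst q c) x y <-> eval Y c x y.
Proof.
move=> hq; have eqq n m : eval X q n m <-> m = Y n.
  by split=> [h|->]; [apply: eval_functional h (hq n)|apply: hq].
suff -> : eval X (code_subst q c) = eval Y c by [].
elim: c => [||||| f IHf g IHg | f IHf g IHg | f IHf g IHg | f IHf] //=;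
  rewrite ?IHf ?IHg //.
by apply/funext => n; apply/funext => m; apply/propext.
Qed.

Lemma eff_subst (D D' : set real) A {cA : coded A} B {cB : coded B}
    (f : real -> A -> B) (H : real -> real) :
  effective D' f -> effective D (fun X n => H X n) -> (forall X, D X -> D' (H X)) ->
  effective D (fun X a => f (H X) a).
Proof.
move=> [c hc] [q hq] DH; exists (code_subst q c) => X DX a.
by apply/eval_code_subst; [exact: hq|apply: hc; apply: DH].
Qed.

Lemma eff_sub_dom (D D' : set real) A {cA : coded A} B {cB : coded B} (f : real -> A -> B) :
  D `<=` D' -> effective D' f -> effective D f.
Proof. by move=> sDD' [c hc]; exists c => X /sDD'; apply: hc. Qed.

Lemma eff_eq_on (D : set real) A {cA : coded A} B {cB : coded B} (f g : real -> A -> B) :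
  (forall X a, D X -> f X a = g X a) -> effective D f -> effective D g.
Proof. by move=> fg [c hc]; exists c => X DX a; rewrite -fg //; apply: hc. Qed.

(** Unbounded search. All outcomes are described, because whether the search
    halts also serves as the test for a semidecidable property. *)
Lemma search_code (D : set real) A {cA : coded A} (p : real -> A * nat -> bool) :
  effective D p -> exists c, forall X, D X -> forall a y,
    eval X c (num a) y <-> p X (a, y) /\ forall m, m < y -> ~~ p X (a, m).
Proof.
move=> /eff_negb[c hc]; exists (Mu c) => X DX a y /=.
have evE m v : eval X c (pair_nat (num a) m) v <-> v = ~~ p X (a, m).
  have h := hc _ DX (a, m).
  by split=> [/(eval_functional h)|-> //].
split=> [[/evE py pm]|[py pm]].
  split; first by case: (p X (a, y)) py.
  by move=> m /pm[u /evE]; case: (p X (a, m)).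
split; first by apply/evE; rewrite py.
by move=> m /pm npm; exists 0; apply/evE; rewrite npm.
Qed.

Lemma least_witness (p : pred nat) : (exists n, p n) ->
  exists n, p n /\ forall m, m < n -> ~~ p m.
Proof.
move=> ex; case: (ex_minnP ex) => n pn nmin; exists n; split=> // m.
by rewrite ltnNge; apply: contra => /nmin.
Qed.

Notation recursive_in Y f := (effective [set Y] (fun _ => f)).

Lemma turing_leP (A B : real) : A <=T B <-> recursive_in B (A : nat -> bool).
Proof.
split=> [[e he]|[c hc]]; first by exists (decode e) => _ -> n; apply: he.
by exists (encode c) => n; rewrite /Phi encodeK; apply: hc.
Qed.

Lemma recursive_trans (X Y : real) A {cA : coded A} B {cB : coded B} (f : A -> B) :
  recursive_in X f -> X <=T Y -> recursive_in Y f.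
Proof.
move=> hf /turing_leP hX.
exact: (eff_subst (H := fun _ => X) hf hX (fun _ _ => erefl)).
Qed.

Lemma eff_at (Y : real) A {cA : coded A} B {cB : coded B} (f : real -> A -> B) :
  effective setT f -> recursive_in Y (f Y).
Proof. by move=> [c hc]; exists c => _ -> a; apply: hc. Qed.

(** Effectively enumerable types are those that an unbounded search can run
    through. *)
Definition enumerable (T : Type) {cT : coded T} : Prop :=
  exists e : nat -> T, effective setT (fun _ => e) /\ forall t, exists n, e n = t.
Arguments enumerable T {cT}.

Lemma enumerable_nat : enumerable nat.
Proof. by exists id; split; [apply: eff_id|move=> n; exists n]. Qed.

Lemma enumerable_prod A {cA : coded A} B {cB : coded B} :
  enumerable A -> enumerable B -> enumerable (A * B).
Proof.
move=> [e [he se]] [f [hf sf]].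
exists (fun n => (e (Cantor.of_nat n).1, f (Cantor.of_nat n).2)); split.
  by apply: eff_pair; [apply: (eff_comp (f := fun _ => e)) => //|
    apply: (eff_comp (f := fun _ => f)) => //]; eff.
move=> [a b]; have [n <-] := se a; have [m <-] := sf b.
by exists (pair_nat n m); rewrite of_pair_nat.
Qed.

(** Reads the digits of a bijective base-2 numeral; n rounds are more than
    enough to exhaust the numeral n, and once it is empty nothing changes. *)
Definition read_digit (p : seq bool * nat) : seq bool * nat :=
  if p.2 == 0 then p else (rcons p.1 (odd p.2.-1), p.2.-1./2).

Definition string_of_nat (n : nat) : seq bool :=
  (nat_rect (fun _ => (seq bool * nat)%type) ([::], n) (fun _ => read_digit) n).1.

Lemma string_codeK : cancel string_code string_of_nat.
Proof.
have iterS k p : nat_rect (fun _ => (seq bool * nat)%type) p (fun _ => read_digit) k.+1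
    = nat_rect (fun _ => (seq bool * nat)%type) (read_digit p) (fun _ => read_digit) k.
  by elim: k => //= k ->.
have H k u t : size t <= k ->
    nat_rect (fun _ => (seq bool * nat)%type) (u, string_code t) (fun _ => read_digit) k
    = (u ++ t, 0).
  elim: k u t => [|k IHk] u [|b t] // ht; rewrite ?cats0 // iterS.
    by rewrite -[read_digit _]/(u, string_code [::]) IHk ?cats0.
  have -> : read_digit (u, string_code (b :: t)) = (rcons u b, string_code t).
    by rewrite /read_digit /= oddD odd_double oddb addnC half_bit_double.
  by rewrite IHk // -cats1 -catA.
move=> s; rewrite /string_of_nat H //.
elim: s => //= b s IHs; rewrite ltnS; apply: leq_trans IHs _.
by rewrite -addnn -addnA leq_addr.
Qed.

Lemma eff_string_of_nat (D : set real) A {cA : coded A} (f : real -> A -> nat) :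
  effective D f -> effective D (fun X a => string_of_nat (f X a)).
Proof.
move=> hf; apply: (eff_comp (f := fun _ => string_of_nat)) => //.
apply: (eff_fst (B := seq bool) (C := nat)).
by apply: eff_nat_rect; [eff|rewrite /read_digit; eff|eff].
Qed.
#[global] Hint Resolve eff_string_of_nat : eff.

Lemma enumerable_string : enumerable (seq bool).
Proof.
exists string_of_nat; split; first exact/eff_string_of_nat/eff_id.
by move=> s; exists (string_code s); apply: string_codeK.
Qed.

(** If every number codes an element, then every number codes a list as well,
    and decoding leaves the codes unchanged. *)
Lemma enumerable_seq T {cT : coded T} :
  injective cT -> (forall n, exists t, cT t = n) -> enumerable (seq T).
Proof.
move=> injT surjT; have surj n : exists s : seq T, coded_seq cT s = n.
  elim/ltn_ind: n => -[|n] IHn; first by exists [::].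
  have [t ht] := surjT (Cantor.of_nat n).1.
  have [|s hs] := IHn (Cantor.of_nat n).2.
    have := leq_pair_nat (Cantor.of_nat n).1 (Cantor.of_nat n).2.
    by rewrite pair_of_nat => /andP[].
  by exists (t :: s); rewrite /= hs -[num t]/(cT t) ht pair_of_nat.
have inj : injective (coded_seq cT).
  elim=> [|x s IHs] [|y t] //= [/(congr1 Cantor.of_nat)].
  by rewrite !of_pair_nat => -[/injT -> /IHs ->].
have [e he] := choice surj; exists e; split.
  by exists idc => X _ n; rewrite /num he; apply: eval_idc.
by move=> s; exists (coded_seq cT s); apply: inj; rewrite he.
Qed.

(** Effective dependent choice: the next state is the first one, in the
    enumeration of all states, that is related to the present state.  Primitive
    recursion is strict, so that the search need only succeed on the states that
    are actually reached; the invariant I keeps track of them. *)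
Lemma eff_dep_choice (Y : real) S {cS : coded S} (R : nat * S * S -> bool)
    (I : nat -> S -> Prop) (s0 : S) :
  enumerable S -> recursive_in Y R -> I 0 s0 ->
  (forall k s, I k s -> exists s', R (k, s, s')) ->
  (forall k s s', I k s -> R (k, s, s') -> I k.+1 s') ->
  exists st : nat -> S, [/\ recursive_in Y st, st 0 = s0
    & forall k, I k (st k) /\ R (k, st k, st k.+1)].
Proof.
move=> [e [he se]] hR I0 exR IR.
pose p (_ : real) (q : nat * S * nat) := R (q.1, e q.2).
have hp : effective [set Y] p.
  apply: (eff_comp (f := fun _ => R)) => //; apply: eff_pair; first by eff.
  apply: (eff_comp (f := fun _ => e)); last by eff.
  exact: eff_sub_dom he.
have [c hc] := search_code hp.
have [ce hce] := he.
(* the least solution, where there is one *)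
have lw (q : nat * S) : exists n, (exists m, R (q, e m)) ->
    R (q, e n) /\ forall m, m < n -> ~~ R (q, e m).
  have [ex|nex] := pselect (exists m, R (q, e m)); last by exists 0.
  by have [n hn] := @least_witness (fun m => R (q, e m)) ex; exists n.
have {lw} [g hg] := choice lw.
pose st := nat_rect (fun _ => S) s0 (fun k s => e (g (k, s))).
have stP k : I k (st k) /\ R (k, st k, st k.+1).
  have step j : I j (st j) -> R (j, st j, st j.+1).
    move=> /exR[s' Rs']; have [n en] := se s'.
    by have [] := hg (j, st j); first by exists n; rewrite en.
  suff Ik : I k (st k) by split=> //; apply: step.
  by elim: k => // k IHk; apply: (IR k (st k)) => //; apply: step.
exists st; split=> //.
exists (Comp (Prec (constc (num s0)) (Comp (Comp ce c) Snd)) (Pair Zero idc)) => _ -> k.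
exists (pair_nat 0 k); split.
  by exists 0, k; split=> //; apply: eval_idc.
rewrite eval_prec; elim: k => [|k IHk]; first exact: eval_constc.
exists (num (st k)); split=> //.
exists (num (k, st k)); split; first by rewrite /= of_pair_nat.
exists (g (k, st k)); split; last exact: hce.
have [_ Rk] := stP k; have [] := hg (k, st k); first by exists (g (k, st k)).
by move=> Rg ming; apply/hc.
Qed.

Lemma eff_choice (Y : real) A {cA : coded A} B {cB : coded B} (R : A * B -> bool) :
  enumerable B -> recursive_in Y R -> (forall a, exists b, R (a, b)) ->
  exists g : A -> B, recursive_in Y g /\ forall a, R (a, g a).
Proof.
move=> [e [he se]] hR exR.
pose p (_ : real) (q : A * nat) := R (q.1, e q.2).
have hp : effective [set Y] p.
  apply: (eff_comp (f := fun _ => R)) => //; apply: eff_pair; first by eff.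
  apply: (eff_comp (f := fun _ => e)); last by eff.
  exact: eff_sub_dom he.
have [c hc] := search_code hp.
have [ce hce] := he.
have lw a : exists n, R (a, e n) /\ forall m, m < n -> ~~ R (a, e m).
  have [b Rb] := exR a; have [n en] := se b.
  by apply: (@least_witness (fun m => R (a, e m))); exists n; rewrite en.
have {lw} [g hg] := choice lw; exists (e \o g); split; last by move=> a; case: (hg a).
exists (Comp ce c) => _ -> a; exists (g a); split; last exact: hce.
exact/hc/hg.
Qed.

Lemma jumpP X e : jump X e <-> exists y, Phi e X e y.
Proof. by split=> [/asboolP|h] //; apply/asboolP. Qed.

(** The index of the program [constc w], as a computable function of w. *)
Definition const_index (w : nat) : nat :=
  nat_rect (fun _ => nat) 0 (fun _ n => 5 + (4 * pair_nat 1 n + 1)) w.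

(** The s-m-n theorem in the form used below: instances of a semidecidable
    property reduce uniformly to the jump.  The index for a belongs to a program
    that overwrites its input by a. *)
Lemma jump_index (D : set real) A {cA : coded A} (f : real -> A * nat -> bool) :
  effective D f -> exists g : A -> nat, effective setT (fun _ => g) /\
    forall X a, D X -> (jump X (g a) <-> exists n, f X (a, n)).
Proof.
move=> hf; have [c hc] := search_code hf.
exists (fun a => 5 + (4 * pair_nat (encode c) (const_index (num a)) + 1)); split.
  apply: eff_add; first by eff.
  apply: eff_add; last by eff.
  apply: eff_mul; first by eff.
  apply: eff_pair_nat; first by eff.
  by apply: eff_nat_rect; [eff|eff|apply: eff_num; eff].
have idxE w : const_index w = encode (constc w).
  by elim: w => // w IHw; rewrite /const_index /= -/(const_index w) IHw.
move=> X a DX; rewrite idxE jumpP /Phi.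
rewrite -[5 + _]/(encode (Comp c (constc (num a)))) encodeK.
split=> [[y [u [/(eval_functional (eval_constc X (num a) _)) <-]]]|[n fn]].
  by move=> /hc[] // fy _; exists y.
have [m hm] := @least_witness (fun m => f X (a, m)) (ex_intro _ n fn).
by exists m, (num a); split; [apply: eval_constc|apply/hc].
Qed.

Lemma semi_jump (X : real) A {cA : coded A} (f : A * nat -> bool) :
  recursive_in X f -> recursive_in (jump X) (fun a => `[< exists n, f (a, n) >]).
Proof.
move=> /jump_index[g [hg gP]].
apply: (eff_eq_on (f := fun J a => J (g a))).
  by move=> _ a ->; apply/idP/asboolP => /gP; apply.
by apply: eff_oracle; apply: eff_sub_dom hg.
Qed.

(** * A universal machine *)

Notation fact := (nat * nat * nat)%type.

(** The machine works with facts (e, x, y), read as: program e halts on input x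
    with output y.  A derivation is a list of facts, the most recent one first,
    each of which follows by one clause of [eval] from those behind it. *)
Definition known (D : seq fact) (F : fact) : bool :=
  has (fun G : fact => [&& G.1.1 == F.1.1, G.1.2 == F.1.2 & G.2 == F.2]) D.

Lemma knownE D F : known D F = (F \in D).
Proof.
apply/hasP/idP => [[[[e x] y] hG]|hF]; last by exists F; rewrite // !eqxx.
by case: F => [[e' x'] y'] /= /and3P[/eqP <- /eqP <- /eqP <-].
Qed.

Arguments known : simpl never.

Definition justified_pair (D : seq fact) (a b : nat) (F : fact) : bool :=
  known D (a, F.1.2, (Cantor.of_nat F.2).1) && known D (b, F.1.2, (Cantor.of_nat F.2).2).

Definition justified_comp (D : seq fact) (a b : nat) (F : fact) : bool :=
  has (fun G : fact => [&& G.1.1 == b, G.1.2 == F.1.2 & known D (a, G.2, F.2)]) D.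

Definition justified_prec (D : seq fact) (a b : nat) (F : fact) : bool :=
  let u := (Cantor.of_nat F.1.2).1 in
  let n := (Cantor.of_nat F.1.2).2 in
  if n == 0 then known D (a, u, F.2) else
  has (fun G : fact => [&& G.1.1 == F.1.1, G.1.2 == pair_nat u n.-1
    & known D (b, pair_nat u (pair_nat n.-1 G.2), F.2)]) D.

Definition justified_mu (D : seq fact) (q : nat) (F : fact) : bool :=
  known D (q, pair_nat F.1.2 F.2, 0) &&
  all (fun m => has (fun G : fact =>
    [&& G.1.1 == q, G.1.2 == pair_nat F.1.2 m & 0 < G.2]) D) (iota 0 F.2).

(** The clause of [eval] for the constructor that e encodes; from 5 on this is
    told by the two lowest binary digits of e - 5. *)
Definition justified (s : seq bool) (D : seq fact) (F : fact) : bool :=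
  let e := F.1.1 in let x := F.1.2 in let y := F.2 in
  if e == 0 then y == 0 else
  if e == 1 then y == x.+1 else
  if e == 2 then y == (Cantor.of_nat x).1 else
  if e == 3 then y == (Cantor.of_nat x).2 else
  if e == 4 then (x < size s) && (y == nth false s x) else
  let m := e - 5 in
  let q := m./2./2 in
  if odd m then
    if odd m./2 then justified_mu D q F
    else justified_comp D (Cantor.of_nat q).1 (Cantor.of_nat q).2 F
  else
    if odd m./2 then justified_prec D (Cantor.of_nat q).1 (Cantor.of_nat q).2 F
    else justified_pair D (Cantor.of_nat q).1 (Cantor.of_nat q).2 F.

Fixpoint valid (s : seq bool) (D : seq fact) : bool :=
  if D is F :: D' then justified s D' F && valid s D' else true.

Lemma eff_known (E : set real) A {cA : coded A} (D : real -> A -> seq fact) (e x y : real ->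
    A -> nat) :
  effective E D -> effective E e -> effective E x -> effective E y ->
  effective E (fun X a => known (D X a) (e X a, x X a, y X a)).
Proof.
move=> hD he hx hy; apply: eff_has => //.
rewrite /known /=. by eff. Qed.


#[global] Hint Resolve eff_known : eff.
Lemma eff_justified (E : set real) A {cA : coded A} (s : real -> A -> seq bool)
    (D : real -> A -> seq fact) (F : real -> A -> fact) :
  effective E s -> effective E D -> effective E F ->
  effective E (fun X a => justified (s X a) (D X a) (F X a)).
Proof.
move=> hs hD hF.
rewrite /justified /justified_pair /justified_comp /justified_prec /justified_mu /=.
by eff.
Qed.
#[global] Hint Resolve eff_justified : eff.

Lemma eff_valid (E : set real) A {cA : coded A} (s : real -> A -> seq bool)
    (D : real -> A -> seq fact) :
  effective E s -> effective E D -> effective E (fun X a => valid (s X a) (D X a)).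
Proof.
move=> hs hD; apply: (@eff_ext E A _ bool _ (fun X a => (foldr (fun F (p : seq fact * bool) =>
    (F :: p.1, justified (s X a) p.1 F && p.2)) ([::], true) (D X a)).2)).
  move=> X a; set f := (fun F p => _).
  suff -> : foldr f ([::], true) (D X a) = (D X a, valid (s X a) (D X a)) by [].
  by elim: (D X a) => //= F L ->.
by apply: (eff_snd (B := seq fact) (C := bool)); eff.
Qed.

Lemma decode_fuel_irr k1 k2 n : n < k1 -> n < k2 -> decode_fuel k1 n = decode_fuel k2 n.
Proof.
elim: k1 k2 n => // k1 IHk [|k2] // [|[|[|[|[|n]]]]] // h1 h2 /=.
have /andP[la lb] := leq_pair_nat (Cantor.of_nat (n %/ 4)).1 (Cantor.of_nat (n %/ 4)).2.
rewrite pair_of_nat in la lb.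
have lq : n %/ 4 <= n by apply: leq_div.
case: (Cantor.of_nat _) la lb => a b /= la lb.
rewrite (IHk k2 a) ?(IHk k2 b) ?(IHk k2 (n %/ 4)) //; lia.
Qed.

Lemma decodeE m : decode (m + 5) =
  let q := m./2./2 in
  let c1 := decode (Cantor.of_nat q).1 in let c2 := decode (Cantor.of_nat q).2 in
  if odd m then if odd m./2 then Mu (decode q) else Comp c1 c2
  else if odd m./2 then Prec c1 c2 else Pair c1 c2.
Proof.
have E k : decode_fuel k.+1 (m.+4.+1) =
    let: (a, b) := Cantor.of_nat (m %/ 4) in
    match m %% 4 with
    | 0 => Pair (decode_fuel k a) (decode_fuel k b)
    | 1 => Comp (decode_fuel k a) (decode_fuel k b)
    | 2 => Prec (decode_fuel k a) (decode_fuel k b)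
    | _ => Mu (decode_fuel k (m %/ 4))
    end by [].
rewrite addnC /decode E {E}.
have -> : m %/ 4 = m./2./2 by lia.
have /andP[la lb] := leq_pair_nat (Cantor.of_nat m./2./2).1 (Cantor.of_nat m./2./2).2.
rewrite pair_of_nat in la lb.
have -> : m %% 4 = odd m + (odd m./2).*2 by lia.
have irr a : a <= m./2./2 -> decode_fuel (5 + m) a = decode_fuel a.+1 a.
  by move=> h; apply: decode_fuel_irr; lia.
case: (Cantor.of_nat _) la lb => a b la lb; rewrite [(a, b).1]/= [(a, b).2]/=.
rewrite !irr //; by case: odd; case: odd.
Qed.

Lemma mkseq_prefix T (f : nat -> T) m n : m <= n -> exists t, mkseq f n = mkseq f m ++ t.
Proof.
move=> le_mn; exists [seq f i | i <- iota m (n - m)].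
by rewrite /mkseq -map_cat -{2}(add0n m) -iotaD subnKC.
Qed.

Lemma justified_sound (X : real) n D F : (forall G, G \in D -> eval X (decode G.1.1)
    G.1.2 G.2) ->
  justified (mkseq X n) D F -> eval X (decode F.1.1) F.1.2 F.2.
Proof.
case: F => [[e x] y] hD; rewrite /justified.
have [-> /eqP ->|e0] := eqVneq e 0; first by [].
have [-> /eqP ->|e1] := eqVneq e 1; first by [].
have [-> /eqP ->|e2] := eqVneq e 2; first by [].
have [-> /eqP ->|e3] := eqVneq e 3; first by [].
have [->|e4] := eqVneq e 4.
  by rewrite size_mkseq => /andP[lt_x /eqP ->]; rewrite nth_mkseq.
have ge5 : 5 <= e by lia.
have em : e = (e - 5) + 5 by rewrite subnK.
rewrite [e in decode e]em decodeE; move: (e - 5) em => m em.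
case om: (odd m); case oh: (odd m./2) => /=.
- case/andP; rewrite knownE => /hD h0 /allP hall; split=> // k lt_k.
  have := hall k; rewrite mem_iota => /(_ lt_k) /hasP[[[e' x'] u] /hD /=].
  by move=> + /and3P[/eqP ee /eqP xe u0]; rewrite ee xe -(prednK u0); exists u.-1.
- case/hasP => [[[e' x'] u]] /hD /= + /and3P[/eqP ee /eqP xe].
  by rewrite ee xe knownE => hg /hD hf; exists u.
- rewrite /justified_prec /= => hF.
  have := pair_of_nat x; case: (Cantor.of_nat x) hF => a [|k] /=.
    by rewrite knownE => /hD.
  move=> /hasP[[[e' x'] u] /hD /= + /and3P[/eqP ee /eqP xe]].
  rewrite ee xe knownE => he /hD /= hf _; exists u; split=> //.
  by move: he; rewrite em decodeE om oh /= of_pair_nat.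
- rewrite /justified_pair !knownE => /andP[/hD h1 /hD h2].
  by do 2!eexists; split; [exact: h1|exact: h2|rewrite pair_of_nat].
Qed.

Lemma valid_sound (X : real) n D : valid (mkseq X n) D ->
  forall F, F \in D -> eval X (decode F.1.1) F.1.2 F.2.
Proof.
elim: D => //= F D IHD /andP[hF /IHD {}IHD] G; rewrite inE => /orP[/eqP ->|/IHD //].
exact: justified_sound hF.
Qed.

Lemma justified_mono (s t : seq bool) D L F :
  {subset D <= L} -> justified s D F -> justified (s ++ t) L F.
Proof.
move=> sDL; have kn G : known D G -> known L G by rewrite !knownE; apply: sDL.
have hs (p q : pred fact) : (forall G, p G -> q G) -> has p D -> has q L.
  by move=> pq /hasP[G /sDL GL /pq qG]; apply/hasP; exists G.
rewrite /justified; do 4!case: ifP => // _; case: ifP => _.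
  by case/andP=> lt_x; rewrite size_cat nth_cat lt_x ltn_addr.
move: (F.1.1 - 5) => m /=; case: ifP => _; case: ifP => _.
- case/andP=> /kn h1 /allP h2; rewrite /justified_mu h1; apply/allP => k /h2.
  exact: hs.
- by apply: hs => G /and3P[-> -> /kn ->].
- rewrite /justified_prec; case: ifP => _; first exact: kn.
  by apply: hs => G /and3P[-> -> /kn ->].
- by case/andP=> /kn h1 /kn h2; apply/andP.
Qed.

Lemma valid_mono (s t : seq bool) D : valid s D -> valid (s ++ t) D.
Proof.
elim: D => //= F D IHD /andP[hF /IHD ->]; rewrite andbT.
exact: justified_mono hF.
Qed.

Lemma valid_cat s D L : valid s D -> valid s L -> valid s (D ++ L).
Proof.
elim: D => //= F D IHD /andP[hF hD] hL; rewrite IHD // andbT -(cats0 s).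
by apply: justified_mono hF => G; rewrite mem_cat => ->.
Qed.

Definition derivable (X : real) (L : seq fact) : Prop :=
  exists n D, valid (mkseq X n) D /\ {subset L <= D}.

Lemma valid_leq (X : real) n m D : n <= m -> valid (mkseq X n) D -> valid (mkseq X m) D.
Proof. by move=> /(mkseq_prefix X)[t ->]; apply: valid_mono. Qed.

Lemma derivable_cat X L M : derivable X L -> derivable X M -> derivable X (L ++ M).
Proof.
move=> [n [D [vD sL]]] [m [E [vE sM]]]; exists (maxn n m), (D ++ E); split.
  by apply: valid_cat; [apply: valid_leq vD|apply: valid_leq vE]; lia.
by move=> F; rewrite !mem_cat => /orP[/sL ->|/sM ->]; rewrite ?orbT.
Qed.

Lemma derivable_step X L F : derivable X L ->
  (exists n, justified (mkseq X n) L F) -> derivable X (F :: L).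
Proof.
move=> [n [D [vD sL]]] [m jF]; exists (maxn n m), (F :: D); split=> /=.
  apply/andP; split; last by apply: valid_leq vD; lia.
  by have [t ->] := mkseq_prefix X (leq_maxr n m); apply: justified_mono jF.
by move=> G; rewrite !inE => /orP[->|/sL ->] //; rewrite orbT.
Qed.

Lemma derivable_sub X L M : {subset M <= L} -> derivable X L -> derivable X M.
Proof. by move=> sML [n [D [vD sL]]]; exists n, D; split=> // F /sML /sL. Qed.

Lemma derivable_nil X : derivable X [::].
Proof. by exists 0, [::]. Qed.

Lemma encode_shape q r : r < 4 ->
  [/\ 5 + (4 * q + r) - 5 = 4 * q + r, (4 * q + r)./2./2 = q, odd (4 * q + r) = odd r
    & odd (4 * q + r)./2 = odd r./2].
Proof. by move=> lt_r; split; lia. Qed.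

(** Completeness: computations use finitely many facts and oracle questions, so
    their derivations can be merged. *)
Lemma eval_derivable X c x y : eval X c x y -> derivable X [:: (encode c, x, y)].
Proof.
have basic F : (exists n, justified (mkseq X n) [::] F) -> derivable X [:: F].
  exact: derivable_step (derivable_nil X).
have mem1 F (L : seq fact) : {subset [:: F] <= F :: L}.
  by move=> G; rewrite !inE => ->.
elim: c x y => [||||| f IHf g IHg | f IHf g IHg | f IHf g IHg | f IHf] x y.
- by move=> /= ->; apply: basic; exists 0.
- by move=> /= ->; apply: basic; exists 0; rewrite /justified /=.
- by move=> /= ->; apply: basic; exists 0; rewrite /justified /=.
- by move=> /= ->; apply: basic; exists 0; rewrite /justified /=.
- move=> /= ->; apply: basic; exists x.+1.
  by rewrite /justified; cbv zeta; rewrite size_mkseq nth_mkseq ?ltnSn ?eqxx.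
- move=> /= [u [v [/IHf hf /IHg hg ->]]].
  have := derivable_cat hf hg => /derivable_step H.
  apply: (derivable_sub (mem1 _ _)); apply: H; exists 0.
  have [] := @encode_shape (pair_nat (encode f) (encode g)) 0 isT.
  rewrite addn0 /justified => -> -> -> -> /=.
  by rewrite /justified_pair !of_pair_nat !knownE !inE !eqxx orbT.
- move=> /= [u [/IHg hg /IHf hf]].
  have := derivable_cat hf hg => /derivable_step H.
  apply: (derivable_sub (mem1 _ _)); apply: H; exists 0.
  have [] := @encode_shape (pair_nat (encode f) (encode g)) 1 isT.
  rewrite /justified => -> -> -> -> /=.
  by rewrite /justified_comp of_pair_nat /= !knownE !inE !eqxx orbT.
- rewrite -(pair_of_nat x); case: (Cantor.of_nat x) => a n /=; rewrite of_pair_nat.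
  have [s1 s2 s3 s4] := @encode_shape (pair_nat (encode f) (encode g)) 2 isT.
  elim: n y => [|n IHn] y /=.
    move=> /IHf /derivable_step H.
    apply: (derivable_sub (mem1 _ _)); apply: H; exists 0.
    rewrite /justified s1 s2 s3 s4 /= /justified_prec /= !of_pair_nat /=.
    by rewrite knownE inE.
  move=> [u [/IHn hu /IHg hg]].
  have := derivable_cat hu hg => /derivable_step H.
  apply: (derivable_sub (mem1 _ _)); apply: H; exists 0.
  rewrite /justified s1 s2 s3 s4 /= /justified_prec /= !of_pair_nat /=.
  by rewrite !knownE !inE !eqxx ?orbT.
- move=> /= [/IHf h0 hpos].
  have [L [dL hL]] : exists L, derivable X L /\ forall m, m < y ->
      exists u, (encode f, pair_nat x m, u.+1) \in L.
    elim: y {h0} hpos => [|y IHy] hpos; first by exists [::]; split=> //; exact: derivable_nil.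
    have [|L [dL hL]] := IHy; first by move=> m lt_m; apply: hpos; lia.
    have [u /IHf hu] := hpos y (ltnSn y).
    exists ([:: (encode f, pair_nat x y, u.+1)] ++ L); split; first exact: derivable_cat.
    move=> m; rewrite ltnS leq_eqVlt => /orP[/eqP ->|/hL[v hv]].
      by exists u; rewrite inE eqxx.
    by exists v; rewrite inE hv orbT.
  have := derivable_cat h0 dL => /derivable_step H.
  apply: (derivable_sub (mem1 _ _)); apply: H; exists 0.
  have [s1 s2 s3 s4] := @encode_shape (encode f) 3 isT.
  rewrite /justified s1 s2 s3 s4 /= /justified_mu /= knownE !inE eqxx /=.
  apply/allP => m; rewrite mem_iota => /hL[u hu]; apply/orP; right.
  by apply/hasP; exists (encode f, pair_nat x m, u.+1); rewrite //= !eqxx.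
Qed.

Lemma decodeK : cancel decode encode.
Proof.
elim/ltn_ind => n IHn; have [lt5|ge5] := ltnP n 5.
  by case: n lt5 {IHn} => [|[|[|[|[|n]]]]].
rewrite -(subnK ge5) decodeE; move: (n - 5) (subnK ge5) => m em.
have /andP[la lb] := leq_pair_nat (Cantor.of_nat m./2./2).1 (Cantor.of_nat m./2./2).2.
rewrite pair_of_nat in la lb.
case om: (odd m); case oh: (odd m./2); rewrite /= !IHn ?pair_of_nat; lia.
Qed.

Lemma enumerable_facts : enumerable (seq fact).
Proof.
apply: enumerable_seq.
  move=> [[e x] y] [[e' x'] y'] /(congr1 Cantor.of_nat).
  rewrite /num /= !of_pair_nat.
  case=> /(congr1 Cantor.of_nat); rewrite !of_pair_nat => -[he hx] hy.
  by have [-> -> ->] : [/\ e = e', x = x' & y = y'].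
move=> n; exists (Cantor.of_nat (Cantor.of_nat n).1, (Cantor.of_nat n).2).
by rewrite -[RHS]pair_of_nat -[in RHS](pair_of_nat (Cantor.of_nat n).1).
Qed.

(** E s F searches the derivations of code below the length of s for one that
    contains F and consults only the finite oracle s; thus longer strings see
    more computations. *)
Lemma universal_machine : exists E : seq bool -> fact -> bool,
  [/\ effective setT (fun _ p => E p.1 p.2),
      forall s t F, E s F -> E (s ++ t) F
    & forall X e x y, eval X (decode e) x y <-> exists n, E (mkseq X n) (e, x, y)].
Proof.
have [dec [hdec sdec]] := enumerable_facts.
exists (fun s F => has (fun i => valid s (dec i) && known (dec i) F) (iota 0 (size s))); split.
- have hd : effective setT (fun (_ : real) (q : seq bool * fact * nat) => dec q.2) by eff.
  apply: eff_has; last by eff.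
  apply: eff_andb; first by apply: eff_valid => //; eff.
  by rewrite /known; eff.
- move=> s t F /hasP[i]; rewrite mem_iota => lt_i /andP[vi ki].
  apply/hasP; exists i; first by rewrite mem_iota size_cat; lia.
  by rewrite ki valid_mono.
move=> X e x y; split=> [|[n /hasP[i _ /andP[/valid_sound h]]]]; last first.
  by rewrite knownE => /h.
move=> /eval_derivable; rewrite decodeK => -[n [D [vD sD]]].
have [i di] := sdec D; exists (maxn n i.+1); apply/hasP; exists i.
  by rewrite mem_iota size_mkseq; lia.
rewrite di knownE sD ?inE // andbT; apply: valid_leq vD; lia.
Qed.

Lemma jump_approximation : exists H : seq bool -> nat -> bool,
  [/\ effective setT (fun _ p => H p.1 p.2),
      forall s t e, H s e -> H (s ++ t) e
    & forall X e, jump X e <-> exists n, H (mkseq X n) e].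
Proof.
have [E [hE Emono EP]] := universal_machine.
exists (fun s e => has (fun y => E s (e, e, y)) (iota 0 (size s))); split.
- have hE' : effective setT (fun (_ : real) (q : seq bool * nat * nat) =>
      E q.1.1 (q.1.2, q.1.2, q.2)).
    by apply: (eff_comp (f := fun _ p => E p.1 p.2)
      (g := fun (_ : real) (q : seq bool * nat * nat) => (q.1.1, (q.1.2, q.1.2, q.2)))) => //; eff.
  by apply: eff_has => //; eff.
- move=> s t e /hasP[y]; rewrite mem_iota => lt_y Ey; apply/hasP; exists y; last exact: Emono.
  by rewrite mem_iota size_cat; lia.
move=> X e; rewrite jumpP /Phi; split=> [[y /EP[n En]]|[n /hasP[y _ Ey]]]; last first.
  by exists y; apply/EP; exists n.
exists (maxn n y.+1); apply/hasP; exists y; first by rewrite mem_iota size_mkseq; lia.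
by have [t ->] := mkseq_prefix X (leq_maxl n y.+1); apply: Emono.
Qed.

(** [halted s e] says that program [e] is seen to halt on input [e] by a
    computation that only consults the finite oracle [s]. *)
Definition halted : seq bool -> nat -> bool := projT1 (cid jump_approximation).

Lemma eff_halted (D : set real) A {cA : coded A} (s : real -> A -> seq bool) (e : real -> A ->
    nat) :
  effective D s -> effective D e -> effective D (fun X a => halted (s X a) (e X a)).
Proof.
move=> hs he; have [hH _ _] := projT2 (cid jump_approximation).
apply: (eff_comp (f := fun _ p => halted p.1 p.2) (g := fun X a => (s X a, e X a))); last by eff.
exact: eff_sub_dom hH.
Qed.
#[global] Hint Resolve eff_halted : eff.

Lemma halted_mono s t e : prefix s t -> halted s e -> halted t e.
Proof.
by move=> /prefixP[u ->]; have [_ + _] := projT2 (cid jump_approximation); apply.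
Qed.

Lemma haltedP X e : jump X e <-> exists n, halted (mkseq X n) e.
Proof. by have [_ _ +] := projT2 (cid jump_approximation); apply. Qed.

(** * Initial segments *)

Definition initial (w : seq bool) (X : real) : bool := prefix w (mkseq X (size w)).

Lemma initialE w X : initial w X = (mkseq X (size w) == w).
Proof. by rewrite /initial prefixE -{1}(size_mkseq X (size w)) take_size. Qed.

Lemma initialP w X : reflect (forall i, i < size w -> X i = nth false w i) (initial w X).
Proof.
rewrite initialE; apply: (iffP eqP) => [{2}<- i lt_i|h]; first by rewrite nth_mkseq.
apply: (@eq_from_nth _ false); rewrite size_mkseq // => i lt_i.
by rewrite nth_mkseq // h.
Qed.

Lemma eff_initial (D : set real) A {cA : coded A} (w : real -> A -> seq bool) (Y : real ->
    A -> real) :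
  effective D w -> effective D (fun X (p : A * nat) => Y X p.1 p.2) ->
  effective D (fun X a => initial (w X a) (Y X a)).
Proof. by move=> hw hY; apply: eff_prefix => //; apply: eff_mkseq => //; eff. Qed.

Lemma prefix_nth (v w : seq bool) i : prefix v w -> i < size v -> nth false w i = nth false v i.
Proof. by move=> /prefixP[t ->] lt_i; rewrite nth_cat lt_i. Qed.

Lemma initial_prefix v w X : prefix v w -> initial w X -> initial v X.
Proof.
move=> pvw /initialP h; apply/initialP => i lt_i.
by rewrite h ?(prefix_nth pvw) //; apply: leq_trans lt_i (size_prefix pvw).
Qed.

Lemma initial_comparable v w X : initial v X -> initial w X -> size v <= size w -> prefix v w.
Proof.
move=> /initialP hv /initialP hw le; rewrite prefixE; apply/eqP.
apply: (@eq_from_nth _ false) => [|i]; rewrite size_takel // => lt_i.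
by rewrite nth_take // -hv // hw //; apply: leq_trans lt_i le.
Qed.

Lemma initial_mkseq X n : initial (mkseq X n) X.
Proof. by rewrite initialE size_mkseq. Qed.

Lemma prefix_rcons_eq (s t : seq bool) b : prefix s (rcons t b)
    = prefix s t || (s == rcons t b).
Proof.
apply/idP/orP => [|[/prefixP[u ->]|/eqP ->]]; last exact: prefix_refl.
  case/prefixP; elim/last_ind => [|u c _]; first by rewrite cats0 => <-; right.
  by rewrite -rcons_cat => /rcons_inj[-> _]; left; apply: prefix_prefix.
by rewrite rcons_cat prefix_prefix.
Qed.

(** * Trees of moves *)

(** The part of the join of d and X that is known once t is known to be an
    initial segment of X. *)
Definition weave (d : real) (t : seq bool) : seq bool :=
  mkseq (join d (nth false t)) (size t).*2.

Definition forces (d : real) (t : seq bool) (e : nat) : bool := halted (weave d t) e.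

Lemma weave_mkseq d X n : weave d (mkseq X n) = mkseq (join d X) n.*2.
Proof.
rewrite /weave size_mkseq; apply/eq_in_map => i; rewrite mem_iota /= => lt_i.
by rewrite /join; case: ifP => // _; rewrite nth_mkseq //; lia.
Qed.

Lemma forces_mono d s t e : prefix s t -> forces d s e -> forces d t e.
Proof.
move=> pst; apply: halted_mono; rewrite /weave; have le := size_prefix pst.
have le2 : (size s).*2 <= (size t).*2 by rewrite leq_double.
have [u ->] := mkseq_prefix (join d (nth false t)) le2.
suff -> : mkseq (join d (nth false s)) (size s).*2 = mkseq (join d (nth false t)) (size s).*2.
  exact: prefix_prefix.
apply/eq_in_map => i; rewrite mem_iota /= => lt_i; rewrite /join; case: ifP => // _.
by rewrite (prefix_nth pst) //; lia.
Qed.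

(** Semantically, forcing by initial segments of X is membership in the jump of
    the join of d and X. *)
Lemma forcesP d X e : jump (join d X) e <-> exists n, forces d (mkseq X n) e.
Proof.
rewrite haltedP /forces; split=> [] [n]; last by rewrite weave_mkseq; exists n.*2.
move=> h; exists n; rewrite weave_mkseq; apply: halted_mono h.
have [|u ->] := @mkseq_prefix _ (join d X) n n.*2; first lia.
exact: prefix_prefix.
Qed.

Definition transplant (s t u : seq bool) : seq bool :=
  if prefix s u then t ++ drop (size s) u else u.

Lemma cat_drop_prefix (s u : seq bool) : prefix s u -> s ++ drop (size s) u = u.
Proof. by move=> /prefixP[t ->]; rewrite drop_size_cat. Qed.

Lemma size_transplant s t u : prefix s t -> size u <= size (transplant s t u).
Proof.
rewrite /transplant => pst; case: ifP => // psu.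
by rewrite -{1}(cat_drop_prefix psu) !size_cat leq_add2r; apply: size_prefix.
Qed.

Lemma transplant_ext s t u : prefix s t -> ~~ prefix s u || (s == u) ->
    prefix u (transplant s t u).
Proof.
rewrite /transplant => pst; case: ifP => /= [psu /eqP <-|_ _]; last exact: prefix_refl.
by rewrite drop_size cats0.
Qed.

Lemma prefix_total (a b c : seq bool) : prefix a c -> prefix b c -> size a <= size b ->
    prefix a b.
Proof.
move=> ha hb le; apply: (@initial_comparable a b (nth false c)) => //.
  by apply/initialP => i; apply: prefix_nth.
by apply/initialP => i; apply: prefix_nth.
Qed.

Lemma prefix_cat2 (s u v : seq bool) : prefix (s ++ u) (s ++ v) = prefix u v.
Proof. by elim: s => //= x s ->; rewrite eqxx. Qed.

(** Moving the subtree above t down to s preserves and reflects the prefix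
    order, in particular incompatibility. *)
Lemma transplant_prefix s t u v : prefix s t ->
  prefix (transplant s t u) (transplant s t v) = prefix u v.
Proof.
move=> pst; rewrite /transplant; case: ifPn => psu; case: ifPn => psv //.
- by rewrite prefix_cat2 -{2}(cat_drop_prefix psu) -{2}(cat_drop_prefix psv) prefix_cat2.
- apply/idP/idP => puv; last by rewrite (prefix_trans psu puv) in psv.
  case/negP: psv; apply: prefix_trans pst _; apply: prefix_trans puv; exact: prefix_prefix.
- apply/idP/idP => puv.
    have [le|lt] := leqP (size u) (size s).
      apply: prefix_trans psv; apply: prefix_total puv _ le.
      by apply: prefix_trans pst _; apply: prefix_prefix.
    case/negP: psu; apply: prefix_total puv (ltnW lt).
    by apply: prefix_trans pst _; apply: prefix_prefix.
  have [le|lt] := leqP (size u) (size s).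
    apply: (@prefix_trans _ s); first exact: prefix_total puv psv le.
    by apply: prefix_trans pst _; apply: prefix_prefix.
  by case/negP: psu; apply: prefix_total psv puv (ltnW lt).
Qed.

(** The move (u, v) considered at stage s: bring what is at v down to u.  The
    second component of s is idle, so that every move is considered infinitely
    often. *)
Definition move (s : nat) : seq bool * seq bool :=
  let m := Cantor.of_nat (Cantor.of_nat s).1 in (string_of_nat m.1, string_of_nat m.2).

Lemma move_recurrent a b n : exists s, n <= s /\ move s = (a, b).
Proof.
exists (pair_nat (pair_nat (string_code a) (string_code b)) n); split.
  by case/andP: (leq_pair_nat (pair_nat (string_code a) (string_code b)) n).
by rewrite /move !of_pair_nat /= !string_codeK.
Qed.

Arguments move : simpl never.

(** Moves compose on the inside: the last move is applied to the string first,
    and the earlier history then locates the result. *)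
Definition place (h : seq (seq bool * seq bool)) (u : seq bool) : seq bool :=
  foldl (fun u m => transplant m.1 m.2 u) u h.

Section Tree.
Variable r : seq bool -> nat.

(** A positive value e.+1 of the rule r stands for requirement e; the value 0
    means that no requirement is attached. *)
Definition acts (d : real) (h : seq (seq bool * seq bool)) (m : seq bool * seq bool) : bool :=
  [&& prefix m.1 m.2, 0 < r m.1, ~~ forces d (place h m.1) (r m.1).-1
    & forces d (place h m.2) (r m.1).-1].

Definition history (d : real) (s : nat) : seq (seq bool * seq bool) :=
  nat_rect (fun _ => seq (seq bool * seq bool)) [::]
    (fun s h => if acts d h (move s) then move s :: h else h) s.

Definition node (d : real) (s : nat) (u : seq bool) : seq bool := place (history d s) u.

Definition fires (d : real) (s : nat) : bool := acts d (history d s) (move s).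

Definition tree_class (d : real) : set real :=
  [set X | forall s n, exists u, size u = n /\ initial (node d s u) X].

Definition settled (d : real) (u : seq bool) (s : nat) : Prop :=
  forall t, s <= t -> fires d t -> ~~ prefix (move t).1 u.

Implicit Types (d X : real) (u v w : seq bool) (s t : nat).

Lemma nodeS d s u : node d s.+1 u =
  node d s (if fires d s then transplant (move s).1 (move s).2 u else u).
Proof. by rewrite /node /= -/(history d s) -/(fires d s); case: ifP. Qed.

Lemma firesE d s : fires d s =
  [&& prefix (move s).1 (move s).2, 0 < r (move s).1,
      ~~ forces d (node d s (move s).1) (r (move s).1).-1
    & forces d (node d s (move s).2) (r (move s).1).-1].
Proof. by []. Qed.

Lemma fires_prefix d s : fires d s -> prefix (move s).1 (move s).2.
Proof. by case/and4P. Qed.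

Lemma node_prefix d s u v : prefix (node d s u) (node d s v) = prefix u v.
Proof.
elim: s u v => // s IHs u v; rewrite !nodeS IHs; case: ifP => // /fires_prefix.
exact: transplant_prefix.
Qed.

Lemma size_node d s u : size u <= size (node d s u).
Proof.
elim: s u => // s IHs u; rewrite nodeS; apply: leq_trans (IHs _).
by case: ifP => // /fires_prefix; apply: size_transplant.
Qed.

(** The image of the embedding only shrinks with the stages. *)
Lemma node_back d s t u : s <= t -> exists v, size u <= size v /\ node d t u = node d s v.
Proof.
move=> /subnKC <-; elim: (t - s) u => [|k IHk] u; first by exists u; rewrite addn0.
rewrite addnS nodeS; set v := if _ then _ else _.
have [w [le ->]] := IHk v; exists w; split=> //; apply: leq_trans le.
by rewrite /v; case: ifP => // /fires_prefix; apply: size_transplant.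
Qed.

Lemma settled_node d u s t : settled d u s -> s <= t -> node d t u = node d s u.
Proof.
move=> su /subnKC <-; elim: (t - s) => [|k IHk]; first by rewrite addn0.
rewrite addnS nodeS -IHk; case: ifP => // /(su _ (leq_addr _ _)) np.
by rewrite /transplant (negPf np).
Qed.

Lemma settled_prefix d u v s : prefix v u -> settled d u s -> settled d v s.
Proof. by move=> pvu su t le /(su _ le); apply: contra => /prefix_trans; apply. Qed.

Lemma settled_later d u s t : settled d u s -> s <= t -> settled d u t.
Proof. by move=> su le t' le'; apply: su; apply: leq_trans le'. Qed.

Lemma settled_rcons d u b s : settled d u s ->
  (forall t, s <= t -> fires d t -> (move t).1 != rcons u b) -> settled d (rcons u b) s.
Proof.
move=> su sub t le ft; rewrite prefix_rcons_eq negb_or.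
by rewrite (su _ le ft) (sub _ le ft).
Qed.

(** Once the proper prefixes of a node are at rest, its own move makes the
    requirement true for good, so that it never moves again. *)
Lemma settled_fire d u b s t : settled d u s -> s <= t -> fires d t ->
  (move t).1 = rcons u b -> settled d (rcons u b) t.+1.
Proof.
move=> su le ft mt.
have stay k : forces d (node d (t.+1 + k) (rcons u b)) (r (rcons u b)).-1.
  elim: k => [|k IHk].
    rewrite addn0 nodeS ft /transplant mt prefix_refl drop_size cats0.
    by case/and4P: ft; rewrite mt.
  rewrite addnS nodeS; case: ifP => // fk; rewrite /transplant; case: ifP => // pk.
  have le_k : s <= t.+1 + k by lia.
  move: pk; rewrite prefix_rcons_eq (negPf (su _ le_k fk)) orFb => /eqP mk.
  by move: fk; rewrite firesE mk IHk !andbF.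
apply: settled_rcons => [|t' le' ft']; first by apply: settled_later su _; lia.
apply/eqP => mt'; move: ft'; rewrite firesE mt' -(subnKC le') stay /=.
by rewrite !andbF.
Qed.

Hypothesis r_nil : r [::] = 0.

Lemma settled_nil d s : settled d [::] s.
Proof.
move=> t _ /and4P[_ r0 _ _]; apply: contraL r0; rewrite prefixs0 => /eqP ->.
by rewrite r_nil.
Qed.

Lemma settles d u : exists s, settled d u s.
Proof.
elim/last_ind: u => [|u b [s su]]; first by exists 0; apply: settled_nil.
have [[t [le ft mt]]|nf] := pselect (exists t, [/\ s <= t, fires d t & (move t).1 = rcons u b]).
  by exists t.+1; apply: settled_fire su le ft mt.
exists s; apply: settled_rcons => // t le ft; apply/eqP => mt.
by apply: nf; exists t.
Qed.

Lemma settles_level d n : exists s, forall u, size u = n -> settled d u s.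
Proof.
have [f hf] := choice (settles d).
exists (\max_(u : n.-tuple bool) f u) => u /eqP su.
apply: settled_later (hf u) _.
exact: (@leq_bigmax _ (fun u : n.-tuple bool => f u) (Tuple su)).
Qed.

(** A member of the class runs through the final tree, not just through each of
    its approximations: wait until a whole level has settled. *)
Lemma class_node d X n s0 : tree_class d X ->
  exists s u, [/\ s0 <= s, size u = n, settled d u s & initial (node d s u) X].
Proof.
move=> CX; have [s hs] := settles_level d n.
have [u [su iu]] := CX (maxn s s0) n; exists (maxn s s0), u; split=> //.
  exact: leq_maxr.
by apply: settled_later (hs _ su) _; apply: leq_maxl.
Qed.

Lemma initial_node_prefix d s u v X : initial (node d s u) X -> initial (node d s v) X ->
  size u <= size v -> prefix u v.
Proof.
move=> iu iv le; have [leN|ltN] := leqP (size (node d s u)) (size (node d s v)).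
  by rewrite -(node_prefix d s); apply: initial_comparable iu iv leN.
have := initial_comparable iv iu (ltnW ltN); rewrite node_prefix.
move=> pvu; have := size_prefix pvu => le'.
by move: pvu; rewrite prefixE (@take_oversize _ _ u) // => /eqP ->; apply: prefix_refl.
Qed.

(** If u does not force e although the jump contains e, then a settled node v
    above u on X does force e.  The move (u, v) is considered again after
    both have settled, and would be carried out. *)
Lemma jump_decided d X u s e : tree_class d X -> settled d u s -> initial (node d s u) X ->
  r u = e.+1 -> (jump (join d X) e <-> forces d (node d s u) e).
Proof.
move=> CX su iu ru; rewrite forcesP; split=> [[n fn]|fu]; last first.
  by exists (size (node d s u)); move: iu; rewrite initialE => /eqP ->.
case: (boolP (forces d (node d s u) e)) => // nf; exfalso.
have [t [v [le sv sett iv]]] := class_node (maxn n (size u)) s CX.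
have [k [le_k mk]] := move_recurrent u v t.
have le_sk : s <= k by apply: leq_trans le_k.
have puv : prefix u v.
  have iu' : initial (node d t u) X by rewrite (settled_node su le).
  by apply: initial_node_prefix iu' iv _; rewrite sv leq_maxr.
have fk : fires d k.
  rewrite firesE mk puv ru /=.
  rewrite (settled_node su le_sk) nf (settled_node sett le_k).
  apply: forces_mono fn; apply: initial_comparable (initial_mkseq X n) iv _.
  by rewrite size_mkseq; apply: leq_trans (size_node _ _ _); rewrite sv leq_maxl.
by have := su _ le_sk fk; rewrite mk prefix_refl.
Qed.

(** Conversely, every branch of settled nodes converges to a member: the nodes
    of a later stage are nodes of each earlier stage. *)
Lemma class_limit d (u : nat -> seq bool) (s : nat -> nat) :
  (forall k, settled d (u k) (s k)) ->
  (forall k, prefix (u k) (u k.+1) /\ size (u k) < size (u k.+1)) ->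
  let X n := nth false (node d (s n.+1) (u n.+1)) n in
  tree_class d X /\ forall k, initial (node d (s k) (u k)) X.
Proof.
move=> sett inc X.
have pu j k : j <= k -> prefix (u j) (u k).
  move=> /subnKC <-; elim: (k - j) => [|i IHi]; first by rewrite addn0 prefix_refl.
  by rewrite addnS; apply: prefix_trans IHi _; case: (inc (j + i)).
have pN j k : j <= k -> prefix (node d (s j) (u j)) (node d (s k) (u k)).
  move=> /pu pjk; rewrite -(settled_node (sett j) (leq_maxl _ (s k))).
  by rewrite -(settled_node (sett k) (leq_maxr (s j) _)) node_prefix.
have szu k : k <= size (u k).
  by elim: k => // k IHk; apply: leq_ltn_trans IHk _; case: (inc k).
have szN k : k <= size (node d (s k) (u k)) by apply: leq_trans (size_node _ _ _).
have iX k : initial (node d (s k) (u k)) X.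
  apply/initialP => i lt_i; rewrite /X.
  have [le|lt] := leqP k i.+1; first by rewrite (prefix_nth (pN _ _ le)).
  by rewrite (prefix_nth (pN _ _ (ltnW lt))).
split=> // t n.
have [v [le_v eq_v]] := node_back d (u n) (leq_maxr (s n) t).
exists (take n v); split.
  by rewrite size_takel //; apply: leq_trans le_v.
apply: initial_prefix (iX n); rewrite -(settled_node (sett n) (leq_maxl _ t)) eq_v node_prefix.
by rewrite -{2}(cat_take_drop n v) prefix_prefix.
Qed.

End Tree.

(** * Turing reducibility *)

Lemma turing_le_refl X : X <=T X.
Proof. by apply/turing_leP; exists Oracle => _ ->. Qed.

Lemma turing_le_trans X Y Z : X <=T Y -> Y <=T Z -> X <=T Z.
Proof. by move=> /turing_leP h1 h2; apply/turing_leP; apply: recursive_trans h2. Qed.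

Lemma computable_le X Y : computable X -> X <=T Y.
Proof.
move=> cX; apply: turing_le_trans cX _; apply/turing_leP.
by apply: eff_cst.
Qed.

Lemma join_ub X Y Z : X <=T Z -> Y <=T Z -> join X Y <=T Z.
Proof. by move=> /turing_leP hX /turing_leP hY; apply/turing_leP; rewrite /join; eff. Qed.

Definition left_half (X : real) : real := fun n => X n.*2.
Definition right_half (X : real) : real := fun n => X n.*2.+1.

Lemma left_join X Y : left_half (join X Y) = X.
Proof. by apply/funext => n; rewrite /left_half /join odd_double doubleK. Qed.

Lemma right_join X Y : right_half (join X Y) = Y.
Proof. by apply/funext => n; rewrite /right_half /join /= odd_double uphalf_double. Qed.

Lemma join_halves X : join (left_half X) (right_half X) = X.
Proof.
apply/funext => n; rewrite /join /left_half /right_half.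
by rewrite -{4}(odd_double_half n); case: odd.
Qed.

Lemma eff_left_half (D : set real) : effective D (fun X n => left_half X n).
Proof. by rewrite /left_half; eff. Qed.

Lemma eff_right_half (D : set real) : effective D (fun X n => right_half X n).
Proof. by rewrite /right_half; eff. Qed.

Lemma left_half_le X : left_half X <=T X.
Proof. by apply/turing_leP; apply: (eff_at X (eff_left_half setT)). Qed.

Lemma right_half_le X : right_half X <=T X.
Proof. by apply/turing_leP; apply: (eff_at X (eff_right_half setT)). Qed.

Lemma le_joinl X Y : X <=T join X Y.
Proof. by rewrite -{1}(left_join X Y); apply: left_half_le. Qed.

Lemma le_joinr X Y : Y <=T join X Y.
Proof. by rewrite -{1}(right_join X Y); apply: right_half_le. Qed.

Lemma jump_le X Y : X <=T Y -> jump X <=T jump Y.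
Proof.
move=> /turing_leP hX; apply/turing_leP.
have h : recursive_in Y (fun p : nat * nat => halted (mkseq X p.2) p.1).
  by apply: eff_halted; [apply: eff_mkseq; eff|eff].
apply: eff_eq_on (semi_jump h) => _ e _ /=.
by apply/asboolP/idP => /haltedP.
Qed.

Lemma le_jump X : X <=T jump X.
Proof.
have h : recursive_in X (fun p : nat * nat => X p.1).
  by have /turing_leP hX := turing_le_refl X; eff.
apply/turing_leP; apply: eff_eq_on (semi_jump h) => _ n _ /=.
by apply/asboolP/idP => [[]|Xn] //; exists 0.
Qed.

Lemma zero_jump_le X : zero_jump <=T jump X.
Proof. by apply: jump_le; apply: computable_le; apply: turing_le_refl. Qed.

(** Diagonalization. *)
Lemma jump_not_le X : ~ jump X <=T X.
Proof.
move=> /turing_leP hJ.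
have h : recursive_in X (fun p : nat * nat => ~~ jump X p.1) by eff.
have [c hc] := search_code h.
have := jumpP X (encode c); rewrite /Phi encodeK => JP.
have : jump X (encode c) <-> ~~ jump X (encode c).
  rewrite {1}JP; split=> [[y /hc[]]|nJ] //.
  by exists 0; apply/hc.
by case: (jump X _) => -[h1 h2]; [have := h1 isT|have := h2 isT].
Qed.

(** * Effectivity of the tree *)

Lemma eff_move (D : set real) A {cA : coded A} (s : real -> A -> nat) :
  effective D s -> effective D (fun X a => move (s X a)).
Proof. by move=> hs; rewrite /move; eff. Qed.

Lemma eff_transplant (D : set real) A {cA : coded A} (s t u : real -> A -> seq bool) :
  effective D s -> effective D t -> effective D u ->
  effective D (fun X a => transplant (s X a) (t X a) (u X a)).
Proof. by move=> hs ht hu; rewrite /transplant; eff. Qed.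
#[global] Hint Resolve eff_move eff_transplant : eff.

Lemma eff_place (D : set real) A {cA : coded A} (h : real -> A -> seq (seq bool * seq bool))
    (u : real -> A -> seq bool) :
  effective D h -> effective D u -> effective D (fun X a => place (h X a) (u X a)).
Proof. by move=> hh hu; rewrite /place; eff. Qed.
#[global] Hint Resolve eff_place : eff.

Lemma eff_forces (D : set real) A {cA : coded A} (d : real -> real) (t : real -> A -> seq bool)
    (e : real -> A -> nat) :
  effective D (fun X n => d X n) -> effective D t -> effective D e ->
  effective D (fun X a => forces (d X) (t X a) (e X a)).
Proof.
move=> hd ht he; rewrite /forces; apply: eff_halted => //; rewrite /weave.
apply: eff_mkseq; last by eff.
rewrite /join; apply: eff_if; first by eff.
  by apply: eff_nth; eff.
by apply: (eff_comp (f := fun X n => d X n) (g := fun _ (p : A * nat) => p.2./2)) => //; eff.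
Qed.

Section TreeEff.
Variable r : seq bool -> nat.
Hypothesis hr : forall D : set real, effective D (fun _ => r).

Lemma eff_acts (D : set real) A {cA : coded A} (h : real -> A -> seq (seq bool * seq bool))
    (m : real -> A -> seq bool * seq bool) :
  effective D h -> effective D m -> effective D (fun X a => acts r X (h X a) (m X a)).
Proof.
move=> hh hm; rewrite /acts.
have hrm : effective D (fun X a => r (m X a).1) by eff.
have hX : effective D (fun X n => X n) by eff.
apply: eff_andb; first by eff.
apply: eff_andb; first by eff.
by apply: eff_andb; [apply: eff_negb|]; apply: eff_forces => //; eff.
Qed.

Lemma eff_history (D : set real) A {cA : coded A} (s : real -> A -> nat) :
  effective D s -> effective D (fun X a => history r X (s X a)).
Proof.
move=> hs; apply: eff_nat_rect => //; first by eff.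
by apply: eff_if; [apply: eff_acts; eff|eff|eff].
Qed.

Lemma eff_node (D : set real) A {cA : coded A} (d : real -> real) (s : real -> A -> nat)
    (u : real -> A -> seq bool) :
  effective D (fun X n => d X n) -> effective D s -> effective D u ->
  effective D (fun X a => node r (d X) (s X a) (u X a)).
Proof.
move=> hd hs hu.
have hn : effective setT (fun X (p : nat * seq bool) => node r X p.1 p.2).
  by apply: eff_place; [apply: eff_history; eff|eff].
apply: (eff_comp (f := fun X (p : nat * seq bool) => node r (d X) p.1 p.2)
  (g := fun X a => (s X a, u X a))); last by eff.
exact: (eff_subst hn hd).
Qed.

Lemma eff_fires (D : set real) A {cA : coded A} (d : real -> real) (s : real -> A -> nat) :
  effective D (fun X n => d X n) -> effective D s ->
  effective D (fun X a => fires r (d X) (s X a)).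
Proof.
move=> hd hs.
have hn : effective setT (fun X (s : nat) => fires r X s).
  by apply: eff_acts; [apply: eff_history; eff|eff].
apply: (eff_comp (f := fun X (s : nat) => fires r (d X) s)) => //.
exact: (eff_subst hn hd).
Qed.

(** To be settled means that no later stage disturbs: a Pi01 question about d. *)
Lemma settled_recursive (d : real) :
  recursive_in (jump d) (fun p : seq bool * nat => `[< settled r d p.1 p.2 >]).
Proof.
have /turing_leP hd := turing_le_refl d.
have h : recursive_in d (fun q : seq bool * nat * nat =>
    [&& q.1.2 <= q.2, fires r d q.2 & prefix (move q.2).1 q.1.1]).
  apply: eff_andb; first by eff.
  by apply: eff_andb; [apply: (eff_fires (d := fun _ => d)) => //; eff|eff].
apply: eff_eq_on (eff_negb (semi_jump h)) => _ [u s] _ /=.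
apply/idP/idP => [/asboolPn nex|/asboolP su].
  apply/asboolP => t le ft; apply/negP => pt; apply: nex; exists t.
  by rewrite le ft.
by apply/asboolPn => -[t /and3P[le /(su _ le) /negP]].
Qed.

Hypothesis r_nil : r [::] = 0.

(** Search, with the help of the jump of d, for the settled node on X that is in
    charge of e, and apply [jump_decided]. *)
Lemma jump_le_decided (d X Y : real) : tree_class r d X ->
  (forall e, exists u s, [/\ settled r d u s, initial (node r d s u) X & r u = e.+1]) ->
  X <=T Y -> jump d <=T Y -> jump (join d X) <=T Y.
Proof.
move=> CX dec leX leJ.
have /turing_leP hX := leX.
have /turing_leP hd := turing_le_trans (le_jump d) leJ.
have hs := recursive_trans (settled_recursive d) leJ.
have hR : recursive_in Y (fun q : nat * (seq bool * nat) => [&& `[< settled r d q.2.1 q.2.2 >],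
    initial (node r d q.2.2 q.2.1) X & r q.2.1 == q.1.+1]).
  apply: eff_andb.
    exact: (eff_comp (f := fun _ (p : seq bool * nat) => `[< settled r d p.1 p.2 >])
      (g := fun _ (q : nat * (seq bool * nat)) => (q.2.1, q.2.2)) hs ltac:(eff)).
  apply: eff_andb.
    apply: (eff_initial (Y := fun _ _ => X)); last by eff.
    by apply: (eff_node (d := fun _ => d)) => //; eff.
  by eff.
have [e|g [hg gP]] := eff_choice (enumerable_prod enumerable_string enumerable_nat) hR.
  have [u [s [su iu ru]]] := dec e; exists (u, s).
  by rewrite /= iu ru eqxx !andbT; apply/asboolP.
apply/turing_leP; apply: (eff_eq_on (f := fun _ e => forces d (node r d (g e).2 (g e).1) e)).
  move=> _ e _; have /and3P[/asboolP /= h1 h2 /eqP h3] := gP e.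
  by apply/idP/idP => /(jump_decided r_nil CX h1 h2 h3).
apply: (eff_forces (d := fun _ => d)) => //; last by eff.
by apply: (eff_node (d := fun _ => d)) => //; eff.
Qed.

End TreeEff.

(** * The two trees *)

Definition level_rule (u : seq bool) : nat := size u.

(** The k-th one of a string is responsible for requirement k-1; zeros never
    move, so that they can be used for coding. *)
Definition block_rule (u : seq bool) : nat := if last false u then count id u else 0.

Lemma eff_level_rule (D : set real) : effective D (fun _ => level_rule).
Proof. by apply: eff_size; eff. Qed.

Lemma eff_block_rule (D : set real) : effective D (fun _ => block_rule).
Proof. by apply: eff_if; [eff|apply: eff_count; eff|eff]. Qed.

Lemma level_class_GL1 d X : tree_class level_rule d X -> jump (join d X) <=T join X (jump d).
Proof.
move=> CX; apply: (jump_le_decided eff_level_rule _ CX) => //; last exact: le_joinr.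
  move=> e; have [s [u [_ su sett iu]]] := class_node (r := level_rule) erefl e.+1 0 CX.
  by exists u, s.
exact: le_joinl.
Qed.

Lemma block_settled_zeros d u s n : settled block_rule d u s ->
  settled block_rule d (u ++ nseq n false) s.
Proof.
move=> su; elim: n => [|n IHn]; first by rewrite cats0.
have -> : nseq n.+1 false = rcons (nseq n false) false by elim: n {IHn} => //= n <-.
rewrite -rcons_cat; apply: settled_rcons => // t _ /and4P[_ r0 _ _].
by apply: contraTneq r0 => ->; rewrite /block_rule last_rcons.
Qed.

Lemma block_rule_prefix u e : e < count id u -> exists v, prefix v u /\ block_rule v = e.+1.
Proof.
elim/last_ind: u => // u b IHu lt_e.
have [/IHu[v [pv rv]]|le] := ltnP e (count id u).
  by exists v; split=> //; apply: prefix_trans pv _; apply: prefix_rcons.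
exists (rcons u b); split; first exact: prefix_refl.
move: lt_e; rewrite /block_rule last_rcons -cats1 count_cat /=; case: b => /=; lia.
Qed.

Lemma count_id_nseq (w : seq bool) : count id w = 0 -> w = nseq (size w) false.
Proof. by elim: w => //= -[] //= w IHw /IHw <-. Qed.

(** If no node on X is in charge of e, then the nodes on X have at most e ones.
    Beyond one with as many ones as possible X follows zeros, which never move,
    so that X can be computed from a single stage. *)
Lemma block_class_recursive d X e : tree_class block_rule d X ->
  ~ (exists u s, [/\ settled block_rule d u s, initial (node block_rule d s u) X
       & block_rule u = e.+1]) ->
  X <=T d.
Proof.
move=> CX nex.
pose good u s := settled block_rule d u s /\ initial (node block_rule d s u) X.
have le_e u s : good u s -> count id u <= e.
  move=> [su iu]; rewrite leqNgt; apply/negP => /block_rule_prefix[v [pv rv]].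
  apply: nex; exists v, s; split=> //; first exact: settled_prefix su.
  by apply: initial_prefix iu; rewrite node_prefix.
pose p k := `[< exists u s, good u s /\ count id u = k >].
have exp : exists k, p k.
  have [s [u [_ _ su iu]]] := class_node (r := block_rule) erefl 0 0 CX.
  by exists (count id u); apply/asboolP; exists u, s.
have pe k : p k -> k <= e by move=> /asboolP[u [s [/le_e + <-]]].
have [k /asboolP[u [s [[su iu] cu]]] kmax] := ex_maxnP exp pe.
have iX n : initial (node block_rule d s (u ++ nseq n false)) X.
  have [t [v [le sv sett iv]]] := class_node (r := block_rule) erefl (size u + n) s CX.
  have puv : prefix u v.
    apply: initial_node_prefix iv _; last by rewrite sv leq_addr.
    by rewrite (settled_node su le).
  move: puv sv sett iv => /prefixP[w ->]; rewrite size_cat => /addnI sw sett iv.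
  have c0 : count id w = 0.
    have : count id (u ++ w) <= k by apply: kmax; apply/asboolP; exists (u ++ w), t.
    by rewrite count_cat cu; lia.
  move: sett iv; rewrite (count_id_nseq c0) sw => sett.
  by rewrite (settled_node (block_settled_zeros n su) le).
apply/turing_leP; apply: (eff_eq_on (f := fun _ n =>
    nth false (node block_rule d s (u ++ nseq n.+1 false)) n)).
  move=> _ n _; have /initialP -> // := iX n.+1.
  by apply: leq_trans (size_node _ _ _ _); rewrite size_cat size_nseq; lia.
have /turing_leP hd := turing_le_refl d.
apply: eff_nth; [eff| |eff].
apply: (eff_node eff_block_rule (d := fun _ => d)) => //; first by eff.
apply: eff_cat; first by eff.
apply: (eff_ext (f := fun _ n => mkseq (fun _ => false) n.+1)); last by eff.
by move=> _ n; apply: (@eq_from_nth _ false); rewrite ?size_mkseq ?size_nseq // => i lt_i;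
  rewrite nth_mkseq // nth_nseq lt_i.
Qed.

(** Not uniform: the two cases are told apart by whether X passes infinitely
    many ones. *)
Lemma block_class_GL1 d X : tree_class block_rule d X -> jump (join d X) <=T join X (jump d).
Proof.
move=> CX; have [dec|] := pselect (forall e, exists u s, [/\ settled block_rule d u s,
    initial (node block_rule d s u) X & block_rule u = e.+1]).
  apply: (jump_le_decided eff_block_rule _ CX) => //; [exact: le_joinl|exact: le_joinr].
move=> /existsNP[e /(block_class_recursive CX) leX].
apply: turing_le_trans (le_joinr X (jump d)).
by apply: jump_le; apply: join_ub => //; apply: turing_le_refl.
Qed.

(** The left half of a member is in the first tree and serves as the oracle for
    the second. *)
Definition tree_pair : set real :=
  [set X | tree_class level_rule empty_real (left_half X) /\
           tree_class block_rule (left_half X) (right_half X)].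

Lemma level_GL1 X : tree_class level_rule empty_real X -> jump X <=T join X zero_jump.
Proof.
move=> /level_class_GL1; apply: turing_le_trans; apply: jump_le; exact: le_joinr.
Qed.

Lemma tree_pair_GL1 : tree_pair `<=` GL1.
Proof.
move=> X [C1 C2]; split; last by apply: join_ub; [apply: le_jump|apply: zero_jump_le].
have := block_class_GL1 C2; rewrite join_halves => h.
apply: turing_le_trans h _; apply: join_ub.
  by apply: turing_le_trans (right_half_le X) _; apply: le_joinl.
apply: turing_le_trans (level_GL1 C1) _; apply: join_ub; last exact: le_joinr.
by apply: turing_le_trans (left_half_le X) _; apply: le_joinl.
Qed.

(** * Presentation as a Pi01 class *)

Lemma class_through r d u s : r [::] = 0 -> settled r d u s ->
  exists X, tree_class r d X /\ initial (node r d s u) X.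
Proof.
move=> r0 su; have [f hf] := choice (settles r0 d).
pose v k := u ++ nseq k false.
have inc k : prefix (v k) (v k.+1) /\ size (v k) < size (v k.+1).
  rewrite /v !size_cat !size_nseq; split; last lia.
  by rewrite prefix_cat2; elim: k => //= k ->.
have [CX iX] := class_limit (fun k => hf (v k)) inc.
eexists; split; first exact: CX.
have := iX 0; rewrite /v cats0.
by rewrite -(settled_node su (leq_maxl s (f u))) -(settled_node (hf u) (leq_maxr s (f u))).
Qed.

Definition strings (n : nat) : seq (seq bool) :=
  nat_rect (fun _ => seq (seq bool)) [:: [::]]
    (fun _ l => map (cons true) l ++ map (cons false) l) n.

Arguments strings : simpl never.

Lemma mem_strings n u : (u \in strings n) = (size u == n).
Proof.
have in_cons (c b : bool) v l : (b :: v \in map (cons c) l) = (b == c) && (v \in l).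
  apply/mapP/andP => [[w wl [-> ->]]|[/eqP -> vl]]; first by rewrite eqxx.
  by exists v.
elim: n u => [|n IHn] [|b u] //.
  by rewrite /strings /= mem_cat; apply/norP; split; apply/mapP => -[].
by rewrite /strings /= mem_cat !in_cons -/(strings n) !IHn eqSS; case: b; rewrite /= ?orbF.
Qed.

Lemma eff_strings (D : set real) A {cA : coded A} (n : real -> A -> nat) :
  effective D n -> effective D (fun X a => strings (n X a)).
Proof. by move=> hn; rewrite /strings; eff. Qed.
#[global] Hint Resolve eff_strings : eff.

Lemma tree_classP r d X : tree_class r d X <->
  forall n, has (fun u => initial (node r d (Cantor.of_nat n).1 u) X) (strings (Cantor.of_nat n).2).
Proof.
split=> [CX n|h s n].
  have [u [su iu]] := CX (Cantor.of_nat n).1 (Cantor.of_nat n).2.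
  by apply/hasP; exists u; rewrite // mem_strings su.
have /hasP[u] := h (pair_nat s n).
by rewrite of_pair_nat mem_strings => /eqP su iu; exists u.
Qed.

(** By the use principle, a program that finds X outside P does so on a finite
    initial segment of X. *)
Lemma Pi01_complement (P : set real) (f : real -> nat -> bool) :
  effective setT f -> (forall X, P X <-> forall n, f X n) -> Pi01_class P.
Proof.
move=> hf Pf.
have h : effective setT (fun X (p : nat * nat) => ~~ f X p.2) by eff.
have [g [_ gP]] := jump_index h.
have {}gP X : ~ P X <-> exists n, halted (mkseq X n) (g 0).
  rewrite -haltedP gP //; split=> [nP|[n /= nf] /Pf PX]; last by rewrite PX in nf.
  apply: contrapT => nex; apply: nP; apply/Pf => n.
  by apply: contrapT => nf; apply: nex; exists n; apply/negP.
exists [set s | halted s (g 0)]; split.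
  have h' : effective setT (fun (_ : real) (p : nat * nat) =>
      halted (string_of_nat p.1) (g 0)) by eff.
  have [c hc] := search_code h'; exists (encode c).
  rewrite predeqE => s; split=> [hs|[y]]; last first.
    by rewrite /Phi encodeK => /hc[] // hs _; move: hs; rewrite string_codeK.
  by exists 0; rewrite /Phi encodeK; apply/hc; rewrite //= string_codeK.
rewrite predeqE => X; split=> [PX [s /= hs cs]|nU].
  by move: PX; apply/gP; exists (size s); rewrite cs.
apply: contrapT => /gP[n hn]; apply: nU; exists (mkseq X n) => //.
by rewrite /cylinder /= size_mkseq.
Qed.

Lemma tree_pair_Pi01 : Pi01_class tree_pair.
Proof.
pose inTree r (d X : real) n :=
  has (fun u => initial (node r d (Cantor.of_nat n).1 u) X) (strings (Cantor.of_nat n).2).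
apply: (@Pi01_complement _ (fun X n => inTree level_rule empty_real (left_half X) n &&
    inTree block_rule (left_half X) (right_half X) n)); last first.
  move=> X; split=> [[/tree_classP h1 /tree_classP h2] n|h]; first by rewrite /inTree h1 h2.
  by split; apply/tree_classP => n; case/andP: (h n).
have hl := eff_left_half setT; have hr := eff_right_half setT.
have h0 : effective setT (fun (_ : real) n => empty_real n) by apply: eff_cst.
apply: eff_andb; apply: eff_has; try eff.
  apply: (eff_initial (Y := fun X _ => left_half X)).
    by apply: (eff_node eff_level_rule (d := fun=> empty_real)) => //; eff.
  by apply: (eff_comp (f := fun X n => left_half X n)) => //; eff.
apply: (eff_initial (Y := fun X _ => right_half X)).
  by apply: (eff_node eff_block_rule (d := left_half)) => //; eff.
by apply: (eff_comp (f := fun X n => right_half X n)) => //; eff.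
Qed.

(** * Genericity of the members of the first tree *)

Lemma initial_agree w X Y m : mkseq X m = mkseq Y m -> size w <= m ->
  initial w Y -> initial w X.
Proof.
move=> eqXY le /initialP h; apply/initialP => i lt_i; rewrite -h //.
have := congr1 (fun s => nth false s i) eqXY.
by rewrite /= !nth_mkseq //; apply: leq_trans lt_i le.
Qed.

Lemma initial_eq w X Y m : initial w X -> initial w Y -> m <= size w -> mkseq X m = mkseq Y m.
Proof.
move=> /initialP hX /initialP hY le; apply/eq_in_map => i; rewrite mem_iota => lt_i.
by rewrite hX ?hY //; apply: leq_trans le.
Qed.

(** Take an index of the property in the jump: the node on d that is in charge
    of this index decides the property for all members through the node. *)
Lemma level_generic (f : real -> nat -> bool) d : effective setT f ->
  tree_class level_rule empty_real d ->
  exists m, forall X, tree_class level_rule empty_real X -> mkseq X m = mkseq d m ->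
    ((exists n, f X n) <-> (exists n, f d n)).
Proof.
move=> hf Cd.
have h : effective setT (fun Y (p : nat * nat) => f (right_half Y) p.2).
  apply: (eff_comp (f := fun Y n => f (right_half Y) n)); last by eff.
  exact: (eff_subst hf (eff_right_half setT)).
have [g [_ gP]] := jump_index h.
have [s [u [_ su sett iu]]] := class_node (r := level_rule) erefl (g 0).+1 0 Cd.
have dec X : tree_class level_rule empty_real X -> initial (node level_rule empty_real s u) X ->
    (exists n, f X n) <-> forces empty_real (node level_rule empty_real s u) (g 0).
  move=> CX iX; rewrite -(jump_decided erefl CX sett iX su) gP //.
  by split=> -[n hn]; exists n; move: hn; rewrite /= right_join.
exists (size (node level_rule empty_real s u)) => X CX agree.
by rewrite !dec //; apply: (initial_agree agree).
Qed.

(** The two successors of a settled node of level m carry different members. *)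
Lemma level_perfect d m : tree_class level_rule empty_real d ->
  exists X, [/\ tree_class level_rule empty_real X, mkseq X m = mkseq d m & X <> d].
Proof.
move=> Cd; have [s [u [_ su sett iu]]] := class_node (r := level_rule) erefl m 0 Cd.
have ext b : exists t X, [/\ s <= t, settled level_rule empty_real (rcons u b) t,
    tree_class level_rule empty_real X, mkseq X m = mkseq d m
    & initial (node level_rule empty_real t (rcons u b)) X].
  have [t0 st0] := settles (r := level_rule) erefl empty_real (rcons u b).
  have st := settled_later st0 (leq_maxr s t0).
  have [X [CX iX]] := class_through (r := level_rule) erefl st.
  exists (maxn s t0), X; split=> //; first exact: leq_maxl.
  apply: initial_eq (_ : m <= size (node level_rule empty_real s u)) => //; last first.
    by rewrite -{1}su size_node.
  rewrite -(settled_node sett (leq_maxl s t0)); apply: initial_prefix iX.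
  by rewrite node_prefix prefix_rcons.
have [t1 [X1 [le1 st1 C1 a1 i1]]] := ext true.
have [t2 [X2 [le2 st2 C2 a2 i2]]] := ext false.
have [eq1|neq1] := pselect (X1 = d); last by exists X1.
exists X2; split=> // eq2; move: i1 i2; rewrite eq1 eq2.
rewrite -(settled_node st1 (leq_maxl t1 t2)) -(settled_node st2 (leq_maxr t1 t2)) => i1 i2.
have := initial_node_prefix i1 i2; rewrite !size_rcons => /(_ (leqnn _)).
rewrite prefixE size_rcons take_oversize ?size_rcons // => /eqP.
by move=> /rcons_inj[].
Qed.

(** If d is computable, then to differ from d is Sigma01; [level_generic] would
    make d isolated. *)
Lemma level_noncomputable d : tree_class level_rule empty_real d -> ~ computable d.
Proof.
move=> Cd /turing_leP[c hc].
have h0 : effective setT (fun (_ : real) n => empty_real n) by apply: eff_cst.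
have hd : effective setT (fun _ => d).
  by apply: (eff_subst (D' := [set empty_real]) (H := fun _ => empty_real)
    (f := fun _ => d)) => //; exists c.
have h : effective setT (fun X n => ~~ (X n == d n)) by eff.
have [m gen] := level_generic h Cd.
have [X [CX agree neq]] := level_perfect m Cd.
have [gX _] := gen X CX agree; case: gX => [|n]; last by rewrite eqxx.
apply: contrapT => nex; apply: neq; apply/funext => n; apply/eqP.
by apply: contrapT => nXd; apply: nex; exists n; apply/negP.
Qed.

(** * A special class without pseudojump inversion *)

Lemma tree_pair_nonempty : tree_pair !=set0.
Proof.
have [d [Cd _]] := class_through (r := level_rule) erefl
  (settled_nil (r := level_rule) erefl (d := empty_real) (s := 0)).
have [c [Cc _]] := class_through (r := block_rule) erefl
  (settled_nil (r := block_rule) erefl (d := d) (s := 0)).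
by exists (join d c); split; rewrite left_join ?right_join.
Qed.

Lemma tree_pair_special : special tree_pair.
Proof.
split; first exact: tree_pair_nonempty.
move=> X [CX _] cX; apply: (level_noncomputable CX).
exact: turing_le_trans (left_half_le X) cX.
Qed.

Lemma tree_pair_not_inversion : ~ pseudojump_inversion_property tree_pair.
Proof.
move=> /(_ zero_jump (encode (Mu Succ)) (turing_le_refl _)) [B [PB [_ [_ h]]]].
have noW n : real_of_set (W (encode (Mu Succ)) B) n = false.
  by apply/asboolPn => -[y]; rewrite /Phi encodeK => -[].
apply: (@jump_not_le B); have [h1 _] := tree_pair_GL1 PB.
apply: turing_le_trans h1 (turing_le_trans h _).
have /turing_leP hB := turing_le_refl B.
apply: join_ub; first exact: turing_le_refl.
apply/turing_leP; apply: (eff_eq_on (f := fun _ _ => false)); last by eff.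
by move=> _ n _; rewrite noW.
Qed.

(** * Cone avoidance in the first tree *)

Lemma forces_initial d w X e : initial w X -> forces d w e -> jump (join d X) e.
Proof.
by rewrite initialE => /eqP iw fw; apply/forcesP; exists (size w); rewrite iw.
Qed.

Lemma value_index : exists g : nat * nat * nat -> nat, effective setT (fun _ => g) /\
  forall (X : real) i x y, jump (join empty_real X) (g (i, x, y)) <-> Phi i X x y.
Proof.
have [E [hE _ EP]] := universal_machine.
have h : effective setT (fun Y (p : (nat * nat * nat) * nat) => E (mkseq (right_half Y) p.2) p.1).
  apply: (eff_comp (f := fun _ p => E p.1 p.2)
    (g := fun Y (p : (nat * nat * nat) * nat) => (mkseq (right_half Y) p.2, p.1))) => //.
  apply: eff_pair; last by eff.
  apply: eff_mkseq; last by eff.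
  by apply: (eff_comp (f := fun Y n => right_half Y n)); [exact: eff_right_half|eff].
have [g [hg gP]] := jump_index h; exists g; split=> // X i x y.
rewrite gP // /Phi EP; split=> -[n hn]; exists n; first by move: hn; rewrite /= right_join.
by rewrite /= right_join.
Qed.

Section ConeAvoidance.

Local Notation node0 := (node level_rule empty_real).
Local Notation settled0 := (settled level_rule empty_real).
Local Notation state := (seq bool * nat * nat)%type.
Local Notation class0 := (tree_class level_rule empty_real).

(** Some extension of u excludes that program k computes Z(x).  Otherwise all
    nodes comparable with u that are in charge of the statement that program k
    yields Z(x) force it.  As a member above u cannot make program k yield two
    values, searching for a level that forces a value would compute Z. *)
Lemma undecided_extension (Z : real) (g : nat * nat * nat -> nat) (u : seq bool) s k :
  effective setT (fun _ => g) ->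
  (forall X i x y, jump (join empty_real X) (g (i, x, y)) <-> Phi i X x y) ->
  ~ computable Z -> settled0 u s ->
  exists (u' : seq bool) s' x, let j := g (k, x, nat_of_bool (Z x)) in
    [/\ prefix u u', size u < size u', settled0 u' s', j < size u'
      & ~~ forces empty_real (node0 s' (take j.+1 u')) j].
Proof.
move=> hg gP nZ su; apply: contrapT => none; apply: nZ.
have [X [CX iX]] := class_through (r := level_rule) erefl su.
pose q (p : nat * (nat * nat)) := let j := g (k, p.1, p.2.2) in
  (s <= p.2.1) && all (fun v : seq bool => (prefix u v || prefix v u) ==>
    forces empty_real (node0 p.2.1 v) j) (strings j.+1).
have q_sound x t b : q (x, (t, b)) -> Phi k X x b.
  case/andP=> /= le /allP hall; apply/gP; move: hall; set j := g _ => hall.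
  have [v [sv iv]] := CX t j.+1; apply: (forces_initial iv).
  have iu : initial (node0 t u) X by rewrite (settled_node su le).
  move: (hall v); rewrite mem_strings sv eqxx => /(_ isT) /implyP; apply.
  have [le_uv|/ltnW le_vu] := leqP (size u) (size v).
    by rewrite (initial_node_prefix iu iv).
  by rewrite (initial_node_prefix iv iu) ?orbT.
have q_ex x : exists t, q (x, (t, nat_of_bool (Z x))).
  pose j := g (k, x, nat_of_bool (Z x)).
  have [t0 ht0] := settles_level (r := level_rule) erefl empty_real j.+1.
  exists (maxn s t0); rewrite /q /= leq_maxl /=; apply/allP => v.
  rewrite mem_strings -/j => /eqP sv; apply/implyP => comp; apply: contrapT => nf.
  apply: none; pose w := if prefix u v then v else u.
  have [t1 ht1] := settles (r := level_rule) erefl empty_real (rcons w false).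
  have [puw pvw] : prefix u w /\ prefix v w.
    move: comp; rewrite /w; case: ifP => /= [-> _|_ ->]; by rewrite prefix_refl.
  (* one more bit makes the extension proper even if v is a prefix of u *)
  exists (rcons w false), (maxn (maxn s t0) t1), x => /=; rewrite -/j.
  have le_uw := size_prefix puw; have le_vw := size_prefix pvw.
  have sv' := settled_later (ht0 v sv) (leq_maxr s t0).
  split.
  - exact: prefix_trans puw (prefix_rcons _ _).
  - by rewrite size_rcons.
  - by apply: settled_later ht1 _; apply: leq_maxr.
  - by rewrite size_rcons -sv; apply: leq_trans le_vw _.
  have -> : take j.+1 (rcons w false) = v.
    by move: (prefix_trans pvw (prefix_rcons w false)); rewrite prefixE sv => /eqP.
  by apply/negP; rewrite (settled_node sv' (leq_maxl _ _)).
have q_val x t b : q (x, (t, b)) -> b = Z x.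
  by have [t' /q_sound h] := q_ex x; move=> /q_sound h'; apply: eval_functional h' h.
have hq : recursive_in empty_real q.
  have hg' : recursive_in empty_real g := eff_sub_dom (@subsetT _ _) hg.
  have he : effective [set empty_real] (fun (_ : real) n => empty_real n) by apply: eff_cst.
  have hj : recursive_in empty_real (fun p : nat * (nat * nat) => g (k, p.1, p.2.2)) by eff.
  apply: eff_andb; first by eff.
  apply: eff_all; last by eff.
  apply: (eff_ext (f := fun _ (p : nat * (nat * nat) * seq bool) =>
    ~~ (prefix u p.2 || prefix p.2 u) ||
    forces empty_real (node0 p.1.2.1 p.2) (g (k, p.1.1, p.1.2.2)))).
    by move=> _ p; rewrite implybE.
  apply: eff_orb; first by eff.
  apply: (eff_forces (d := fun=> empty_real)) => //; last by eff.
  by apply: (eff_node eff_level_rule (d := fun=> empty_real)) => //; eff.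
have [x|h [hh hP]] := eff_choice (enumerable_prod enumerable_nat enumerable_nat) hq.
  by have [t qt] := q_ex x; exists (t, nat_of_bool (Z x)).
apply/turing_leP; apply: (eff_eq_on (f := fun _ x => (h x).2 == 1)); last by eff.
by move=> _ x _; have := hP x; case: (h x) => t b /q_val /= ->; case: (Z x).
Qed.

(** Step k takes care of program k by [undecided_extension].  The extension
    is found by a search that needs Z and, to recognize settled nodes, the
    halting problem. *)
Lemma cone_avoidance (d0 A Z : real) m : class0 d0 -> Z <=T A -> zero_jump <=T A ->
  ~ computable Z ->
  exists d, [/\ class0 d, mkseq d m = mkseq d0 m, d <=T A & ~ Z <=T d].
Proof.
move=> C0 leZ le0 nZ; have [g [hg gP]] := value_index.
have [s0 [u0 [_ size0 set0 i0]]] := class_node (r := level_rule) erefl m 0 C0.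
pose J (q : nat * state * state) := g (q.1.1, q.2.2, nat_of_bool (Z q.2.2)).
pose R (q : nat * state * state) := [&& prefix q.1.2.1.1 q.2.1.1, size q.1.2.1.1 < size q.2.1.1,
  `[< settled0 q.2.1.1 q.2.1.2 >], J q < size q.2.1.1
  & ~~ forces empty_real (node0 q.2.1.2 (take (J q).+1 q.2.1.1)) (J q)].
have hA0 : effective [set A] (fun (_ : real) n => empty_real n) by apply: eff_cst.
have hR : recursive_in A R.
  have hset := recursive_trans (settled_recursive eff_level_rule empty_real) le0.
  have hg' : recursive_in A g := eff_sub_dom (@subsetT _ _) hg.
  have /turing_leP hZ := leZ.
  have hJ : recursive_in A J by rewrite /J; eff.
  apply: eff_andb; first by eff.
  apply: eff_andb; first by eff.
  apply: eff_andb.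
    exact: (eff_comp (f := fun _ (p : seq bool * nat) => `[< settled0 p.1 p.2 >])
      (g := fun _ (q : nat * state * state) => (q.2.1.1, q.2.1.2)) hset ltac:(eff)).
  apply: eff_andb; first by eff.
  apply: eff_negb; apply: (eff_forces (d := fun=> empty_real)) => //.
  by apply: (eff_node eff_level_rule (d := fun=> empty_real)) => //; eff.
have [|||st [hst st0 stP]] := @eff_dep_choice A state _ R (fun _ q => settled0 q.1.1 q.1.2)
    (u0, s0, 0) (enumerable_prod (enumerable_prod enumerable_string enumerable_nat) enumerable_nat)
    hR.
- exact: set0.
- move=> k [[u s] x] /= su.
  have [u' [s' [x' [h1 h2 h3 h4 h5]]]] := undecided_extension k hg gP nZ su.
  exists (u', s', x'); rewrite /R /J /= h1 h2 h4 h5 !andbT.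
  exact/asboolP.
- by move=> k q q' _ /and5P[_ _ /asboolP h _ _].
have sett k : settled0 (st k).1.1 (st k).1.2 by case: (stP k).
have inc k : prefix (st k).1.1 (st k.+1).1.1 /\ size (st k).1.1 < size (st k.+1).1.1.
  by case: (stP k) => _ /and5P[].
have [Cd id] := class_limit sett inc.
set d := (fun n => _) in Cd id; exists d; split=> //.
- apply: initial_eq (_ : m <= size (node0 s0 u0)) => //; last by rewrite -{1}size0 size_node.
  by have := id 0; rewrite st0.
- apply/turing_leP; apply: eff_nth; [by eff| |by eff].
  by apply: (eff_node eff_level_rule (d := fun=> empty_real)) => //; eff.
move=> [e he]; have [_ /and5P[_ _ _ /= lt_j /negP nf]] := stP e.
apply: nf; set j := J _ in lt_j *.
have sz : size (take j.+1 (st e.+1).1.1) = j.+1 by rewrite size_takel.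
have pt : prefix (take j.+1 (st e.+1).1.1) (st e.+1).1.1.
  by rewrite -{2}(cat_take_drop j.+1 (st e.+1).1.1) prefix_prefix.
apply: (iffLR (jump_decided (r := level_rule) erefl Cd (settled_prefix pt (sett e.+1)) _ sz)).
  by apply: initial_prefix (id e.+1); rewrite node_prefix.
by apply/gP; apply: he.
Qed.

End ConeAvoidance.

(** * Coding into the second tree *)

Lemma eff_eq_string (D : set real) A {cA : coded A} (s t : real -> A -> seq bool) :
  effective D s -> effective D t -> effective D (fun X a => s X a == t X a).
Proof.
move=> hs ht; apply: (eff_ext (f := fun X a => prefix (s X a) (t X a) && prefix (t X a) (s X a))).
  move=> X a; apply/andP/eqP => [[p1 p2]|->]; last by rewrite prefix_refl.
  move: p1; rewrite prefixE take_oversize ?size_prefix // => /eqP.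
  by [].
by eff.
Qed.
#[global] Hint Resolve eff_eq_string : eff.

Definition block (u : seq bool) (n : nat) : seq bool := rcons (u ++ nseq n false) true.

Lemma eff_block (D : set real) A {cA : coded A} (u : real -> A -> seq bool) (n : real -> A ->
    nat) :
  effective D u -> effective D n -> effective D (fun X a => block (u X a) (n X a)).
Proof.
move=> hu hn; apply: (eff_ext (f := fun X a =>
    rcons (u X a ++ mkseq (fun _ => false) (n X a)) true)); last by eff.
move=> X a; rewrite /block; congr (rcons (_ ++ _) _).
apply: (@eq_from_nth _ false); rewrite ?size_mkseq ?size_nseq // => i lt_i.
by rewrite nth_mkseq // nth_nseq lt_i.
Qed.
#[global] Hint Resolve eff_block : eff.

Lemma block_inj u n m : prefix (block u n) (block u m) -> n = m.
Proof.
rewrite /block !rcons_cat prefix_cat2 => p.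
have nthb k i : nth false (rcons (nseq k false) true) i = (i == k).
  by rewrite nth_rcons size_nseq nth_nseq; case: ltngtP.
have := prefix_nth p (i := n); rewrite size_rcons size_nseq !nthb eqxx.
by move=> /(_ (ltnSn n)) /eqP.
Qed.

Lemma block_grows u n : prefix u (block u n) /\ size u < size (block u n).
Proof.
rewrite /block size_rcons size_cat ltnS leq_addr; split=> //.
by rewrite -cats1 -catA prefix_prefix.
Qed.

(** As long as the proper prefixes are at rest, nodes can only grow. *)
Lemma node_mono r d v b s t : settled r d v s -> s <= t ->
  prefix (node r d s (rcons v b)) (node r d t (rcons v b)).
Proof.
move=> sv /subnKC <-; elim: (t - s) => [|k IHk]; first by rewrite addn0 prefix_refl.
rewrite addnS nodeS; apply: prefix_trans IHk _; rewrite node_prefix.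
case: ifP => [fk|_]; last exact: prefix_refl.
apply: transplant_ext; first exact: fires_prefix fk.
rewrite prefix_rcons_eq (negPf (sv _ (leq_addr _ _) fk)) orFb.
by case: eqP.
Qed.

Lemma fires_unique r d v b s t t' : settled r d v s -> s <= t -> s <= t' ->
  fires r d t -> fires r d t' -> (move t).1 = rcons v b -> (move t').1 = rcons v b -> t = t'.
Proof.
move=> sv le le' ft ft' mt mt'.
by case: (ltngtP t t') => // lt; [have := settled_fire sv le ft mt lt ft'
  |have := settled_fire sv le' ft' mt' lt ft]; rewrite ?mt ?mt' prefix_refl.
Qed.

Definition ce_in (d Z : real) : Prop :=
  exists f : nat * nat -> bool, recursive_in d f /\ forall n, Z n <-> exists m, f (n, m).

(** Post's theorem. *)
Lemma ce_complement (d Z : real) : ce_in d Z -> ce_in d (fun n => ~~ Z n) -> Z <=T d.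
Proof.
move=> [f [hf fP]] [h [hh hP]]; have hR : recursive_in d (fun p => f p || h p) by eff.
have [n|g [hg gP]] := eff_choice enumerable_nat hR.
  have [/fP[m fm]|nZ] := boolP (Z n); first by exists m; rewrite fm.
  by have [m hm] := iffLR (hP n) nZ; exists m; rewrite hm orbT.
apply/turing_leP; apply: (eff_eq_on (f := fun _ n => f (n, g n))); last by eff.
move=> _ n _; have := gP n; case fn: (f _) => /= hn.
  by apply/esym/fP; exists (g n).
by apply/esym/negbTE/hP; exists (g n).
Qed.

Lemma not_ce_version (d Z : real) : ~ Z <=T d ->
  exists Z', ~ ce_in d Z' /\ forall Y, Z <=T Y -> Z' <=T Y.
Proof.
move=> nZ; have [ceZ|nce] := pselect (ce_in d Z); last by exists Z.
exists (fun n => ~~ Z n); split; first by move=> /(ce_complement ceZ).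
by move=> Y /turing_leP hZ; apply/turing_leP; eff.
Qed.

Section PosnerRobinson.

Variable d : real.
Local Notation node2 := (node block_rule d).
Local Notation settled2 := (settled block_rule d).
Local Notation fires2 := (fires block_rule d).
Local Notation state := (seq bool * nat * nat)%type.

Definition event_at (p : state * nat) : bool :=
  [&& p.1.1.2 <= p.2, fires2 p.2 & (move p.2).1 == block p.1.1.1 p.1.2].

(** The event for the state (u, s, n): the node u 0...0 1, with n zeros, moves
    at some stage from s on. *)
Definition event (q : state) : bool := `[< exists t, event_at (q, t) >].

(** [s'] is the stage at which the block u' has settled if u was settled at s:
    the stage after its move if b announces a move, and s otherwise. *)
Definition advance (b : bool) (s s' : nat) (u' : seq bool) : bool :=
  if b then [&& s < s', fires2 s'.-1 & (move s'.-1).1 == u'] else s' == s.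

Lemma eff_fires2 Y A {cA : coded A} (s : real -> A -> nat) : d <=T Y -> effective [set Y] s ->
  effective [set Y] (fun X a => fires2 (s X a)).
Proof.
by move=> /turing_leP hd hs; apply: (eff_fires eff_block_rule (d := fun=> d)) => //; eff.
Qed.

Lemma eff_advance Y A {cA : coded A} b s s' u' : d <=T Y ->
  effective [set Y] b -> effective [set Y] s -> effective [set Y] s' -> effective [set Y] u' ->
  effective [set Y] (fun X (a : A) => advance (b X a) (s X a) (s' X a) (u' X a)).
Proof.
move=> hd hb hs hs' hu; rewrite /advance; apply: eff_if => //; last by eff.
apply: eff_andb; first by eff.
by apply: eff_andb; [apply: eff_fires2; eff|eff].
Qed.

Lemma event_at_recursive Y : d <=T Y -> recursive_in Y event_at.
Proof.
move=> hd; rewrite /event_at; apply: eff_andb; first by eff.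
by apply: eff_andb; [apply: eff_fires2; eff|eff].
Qed.

Lemma event_recursive : recursive_in (jump d) event.
Proof. exact: semi_jump (event_at_recursive (turing_le_refl d)). Qed.

(** If Z(n/2) agreed with the event for all n of parity a, then Z would be c.e.
    in d, since the event is. *)
Lemma event_exists (Z : real) u s (a : bool) : ~ ce_in d Z ->
  exists n, odd n = a /\ Z n./2 != event (u, s, n).
Proof.
move=> nce; apply: contrapT => none; apply: nce.
pose f (p : nat * nat) := event_at ((u, s, a + p.1.*2), p.2).
have oddE m : odd (a + m.*2) = a by rewrite oddD odd_double addbF oddb.
exists f; split.
  have hd := event_at_recursive (turing_le_refl d).
  by rewrite /f; eff.
move=> m; have eq : Z m = event (u, s, a + m.*2).
  apply/eqP; apply: contrapT => ne; apply: none; exists (a + m.*2).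
  by rewrite oddE half_bit_double; split=> //; apply/negP.
by rewrite eq; split=> [/asboolP|h] //; apply/asboolP.
Qed.

Lemma advance_exists q : settled2 q.1.1 q.1.2 ->
  exists s', advance (event q) q.1.2 s' (block q.1.1 q.2).
Proof.
move=> sq; rewrite /advance /event.
case: asboolP => [[t /and3P[/= le ft mt]]|_]; last by exists q.1.2.
by exists t.+1; rewrite ltnS le ft mt.
Qed.

Lemma advance_settled q s' : settled2 q.1.1 q.1.2 ->
  advance (event q) q.1.2 s' (block q.1.1 q.2) -> settled2 (block q.1.1 q.2) s'.
Proof.
move=> /(block_settled_zeros q.2) sq; rewrite /advance /event.
case: asboolP => [_ /and3P[lt ft /eqP mt]|nev /eqP ->].
  have le : q.1.2 <= s'.-1 by rewrite -ltnS (ltn_predK lt).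
  by rewrite -(ltn_predK lt); apply: (settled_fire (b := true) sq le ft mt).
apply: settled_rcons => // t le ft; apply/eqP => mt; apply: nev; exists t.
by apply/and3P; split=> //; apply/eqP.
Qed.

Lemma advance_unique b q s1 s2 : settled2 q.1.1 q.1.2 ->
  advance b q.1.2 s1 (block q.1.1 q.2) -> advance b q.1.2 s2 (block q.1.1 q.2) -> s1 = s2.
Proof.
move=> /(block_settled_zeros q.2) sq; rewrite /advance; case: b => [|/eqP -> /eqP -> //].
move=> /and3P[lt1 f1 /eqP m1] /and3P[lt2 f2 /eqP m2].
have le1 : q.1.2 <= s1.-1 by rewrite -ltnS (ltn_predK lt1).
have le2 : q.1.2 <= s2.-1 by rewrite -ltnS (ltn_predK lt2).
by rewrite -(ltn_predK lt1) -(ltn_predK lt2) (fires_unique (b := true) sq le1 le2 f1 f2 m1 m2).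
Qed.

Lemma advance_leq b s s' u' : advance b s s' u' -> s <= s'.
Proof. by rewrite /advance; case: b => [/and3P[/ltnW]|/eqP ->]. Qed.

(** The sequence of states can be recovered from c by any Y that knows in advance
    which events occur.  Given the state k, the next block is the only one whose
    string at stage s is an initial segment of c, and the next stage is found by
    waiting for the announced move. *)
Lemma decode_history (Y c A : real) (st : nat -> state) (b : state -> bool) :
  d <=T Y -> c <=T Y -> recursive_in Y b ->
  (forall k, settled2 (st k).1.1 (st k).1.2) ->
  (forall k, initial (node2 (st k).1.2 (st k).1.1) c) ->
  (forall k, let q := ((st k).1, (st k.+1).2) in
     [/\ (st k.+1).1.1 = block q.1.1 q.2, odd (st k.+1).2 = A k, b q = event q
       & advance (event q) q.1.2 (st k.+1).1.2 (block q.1.1 q.2)]) ->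
  A <=T Y.
Proof.
move=> leY leC hb sett ini step.
pose R (p : nat * state * state) := let q := (p.1.2.1, p.2.2) in
  [&& p.2.1.1 == block q.1.1 q.2, initial (node2 q.1.2 p.2.1.1) c
    & advance (b q) q.1.2 p.2.1.2 p.2.1.1].
have hR : recursive_in Y R.
  have /turing_leP hc := leC; have /turing_leP hd := leY.
  apply: eff_andb; first by eff.
  apply: eff_andb.
    apply: (eff_initial (Y := fun _ _ => c)); last by eff.
    by apply: (eff_node eff_block_rule (d := fun=> d)) => //; eff.
  by apply: eff_advance => //; eff.
have enumS : enumerable state.
  exact: enumerable_prod (enumerable_prod enumerable_string enumerable_nat) enumerable_nat.
have ini' k : initial (node2 (st k).1.2 (st k.+1).1.1) c.
  have [eq _ _ adv] := step k; rewrite /= in eq adv.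
  apply: initial_prefix (ini k.+1); rewrite eq; apply: node_mono; last exact: advance_leq adv.
  exact: block_settled_zeros.
have [|k _ ->|k _ q' ->|h [hh h0 hP]] :=
  @eff_dep_choice Y state _ R (fun k q => q = st k) (st 0) enumS hR.
- by [].
- exists (st k.+1); have [eq _ eqb adv] := step k; rewrite /= in eq eqb adv.
  by rewrite /R /= eqb -eq eqxx ini' eq adv.
- move=> /and3P[/= /eqP eq' ini2 adv']; have [eq _ eqb adv] := step k; rewrite /= in eq eqb adv.
  have en : (st k.+1).2 = q'.2.
    move: (ini' k) ini2; rewrite eq eq'.
    have [le|/ltnW le] := leqP (st k.+1).2 q'.2 => i1 i2.
      apply: (@block_inj (st k).1.1); apply: initial_node_prefix i1 i2 _.
      by rewrite /block !size_rcons !size_cat !size_nseq; lia.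
    apply/esym/(@block_inj (st k).1.1); apply: initial_node_prefix i2 i1 _.
    by rewrite /block !size_rcons !size_cat !size_nseq; lia.
  have eu : q'.1.1 = (st k.+1).1.1 by rewrite eq eq' en.
  have es : q'.1.2 = (st k.+1).1.2.
    apply: (advance_unique (q := ((st k).1, (st k.+1).2)) (sett k) _ adv).
    by move: adv'; rewrite -en eqb eu eq.
  by move: eu es en; case: q' {eq' ini2 adv'} => [[u' s'] n'] /= -> -> <-; case: (st k.+1) => [[]].
apply/turing_leP; apply: (eff_eq_on (f := fun _ k => odd (h k.+1).2)); last by eff.
by move=> _ k _; have [-> _] := hP k.+1; have [_ -> _ _] := step k.
Qed.

(** The states k are triples (u, s, n) of a node u, a stage s at which it is
    settled, and the number n of zeros in the last block.  Both ways of reading A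
    off use [decode_history]: with Z an event occurs iff Z' does not hold at n/2,
    and the jump answers all questions about events directly. *)
Lemma posner_robinson (A Z : real) u0 s0 : settled2 u0 s0 -> jump d <=T A -> Z <=T A ->
  ~ Z <=T d ->
  exists c, [/\ tree_class block_rule d c, initial (node2 s0 u0) c, c <=T A,
    A <=T join (join d c) Z & A <=T jump (join d c)].
Proof.
move=> sett0 leJ leZ nZ; have [Z' [nce leZ']] := not_ce_version nZ.
have led := turing_le_trans (le_jump d) leJ.
have hev := recursive_trans event_recursive leJ.
pose R (p : nat * state * state) := let q := (p.1.2.1, p.2.2) in
  [&& p.2.1.1 == block q.1.1 q.2, odd p.2.2 == A p.1.1, Z' q.2./2 != event q
    & advance (event q) q.1.2 p.2.1.2 (block q.1.1 q.2)].
have hR : recursive_in A R.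
  have /turing_leP hA := turing_le_refl A; have /turing_leP hZ := leZ' _ leZ.
  apply: eff_andb; first by eff.
  apply: eff_andb; first by eff.
  apply: eff_andb; first by eff.
  by apply: eff_advance => //; eff.
have enumS : enumerable state.
  exact: enumerable_prod (enumerable_prod enumerable_string enumerable_nat) enumerable_nat.
have [|k q sq|k q q' sq|st [hst st0 stP]] := @eff_dep_choice A state _ R
    (fun _ q => settled2 q.1.1 q.1.2) (u0, s0, 0) enumS hR.
- exact: sett0.
- have [n [on nev]] := event_exists q.1.1 q.1.2 (A k) nce.
  have [s' adv] := @advance_exists (q.1, n) sq.
  exists (block q.1.1 n, s', n); rewrite /R /= on !eqxx adv andbT /=.
  by case: q {sq adv} nev => [[]].
- by move=> /and4P[/eqP /= -> _ _ adv]; apply: (@advance_settled (q.1, q'.2)).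
have sett k : settled2 (st k).1.1 (st k).1.2 by case: (stP k).
have step k : let q := ((st k).1, (st k.+1).2) in
     [/\ (st k.+1).1.1 = block q.1.1 q.2, odd (st k.+1).2 = A k, Z' q.2./2 != event q
       & advance (event q) q.1.2 (st k.+1).1.2 (block q.1.1 q.2)].
  by case: (stP k) => _ /and4P[/eqP ? /eqP ? ? ?].
have inc k : prefix (st k).1.1 (st k.+1).1.1 /\ size (st k).1.1 < size (st k.+1).1.1.
  by have [-> _ _ _] := step k; apply: block_grows.
have [Cc ic] := class_limit sett inc.
set c := (fun n => _) in Cc ic; exists c; split=> //.
- by have := ic 0; rewrite st0.
- have /turing_leP hd := led.
  apply/turing_leP; apply: eff_nth; [by eff| |by eff].
  by apply: (eff_node eff_block_rule (d := fun=> d)) => //; eff.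
- apply: (@decode_history _ c A st (fun q => ~~ Z' q.2./2)) => //.
  + by apply: turing_le_trans (le_joinl _ _) (le_joinl _ _).
  + by apply: turing_le_trans (le_joinr _ _) (le_joinl _ _).
  + by have /turing_leP hZ := leZ' _ (le_joinr (join d c) Z); eff.
  move=> k q; have [h1 h2 h3 h4] := step k; split=> //.
  by move: h3; rewrite -/q; case: (Z' _); case: (event q).
apply: (@decode_history _ c A st event) => //.
- by apply: turing_le_trans (le_joinl _ _) (le_jump _).
- by apply: turing_le_trans (le_joinr _ _) (le_jump _).
- by apply: recursive_trans event_recursive _; apply: jump_le; apply: le_joinl.
by move=> k q; have [h1 h2 h3 h4] := step k.
Qed.

End PosnerRobinson.

(** * The Join Property *)

(** That u is still settled at s0 is a Pi01 property of the oracle d, and that it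
    carries the same string is decidable, so both survive the passage from d0 to
    a d in D which agrees with d0 far enough. *)
Lemma tree_pair_local_join (s : seq bool) :
  tree_pair `&` cylinder s !=set0 -> join_property (tree_pair `&` cylinder s).
Proof.
move=> [X0 [[C1 C2] cyl]] A Z leA nZ; set d0 := left_half X0 in C1 C2.
have leZ : Z <=T A := turing_le_trans (le_joinl _ _) leA.
have le0 : zero_jump <=T A := turing_le_trans (le_joinr _ _) leA.
have [s0 [u [_ su sett iu]]] := class_node (r := block_rule) erefl (size s) 0 C2.
(* u is the node of level [size s] through which the right half runs *)
pose w := node block_rule d0 s0 u.
pose f1 X t := [&& s0 <= t, fires block_rule X t & prefix (move t).1 u].
pose f2 X (_ : nat) := node block_rule X s0 u == w.
have hX : effective setT (fun (X : real) n => X n) by eff.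
have hf1 : effective setT f1.
  apply: eff_andb; first by eff.
  by apply: eff_andb; [apply: (eff_fires eff_block_rule (d := id)) => //; eff|eff].
have hf2 : effective setT f2.
  by apply: eff_eq_string; [apply: (eff_node eff_block_rule (d := id)) => //; eff|eff].
have [m1 gen1] := level_generic hf1 C1.
have [m2 gen2] := level_generic hf2 C1.
have [d [Cd agree led nZd]] := cone_avoidance (maxn (size s) (maxn m1 m2)) C1 leZ le0 nZ.
have agree' m : m <= maxn (size s) (maxn m1 m2) -> mkseq d m = mkseq d0 m.
  move=> le; apply: (initial_eq (initial_mkseq d (maxn (size s) (maxn m1 m2)))).
    by rewrite agree; apply: initial_mkseq.
  by rewrite size_mkseq.
have settd : settled block_rule d u s0.
  move=> t le ft; apply/negP => pt.
  have [|t' /and3P[le' ft' pt']] := iffLR (gen1 d Cd (agree' m1 ltac:(lia))).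
    by exists t; rewrite /f1 le ft pt.
  by have := sett t' le' ft'; rewrite pt'.
have eqw : node block_rule d s0 u = w.
  have [|_ /eqP //] := iffRL (gen2 d Cd (agree' m2 ltac:(lia))).
  by exists 0; rewrite /f2.
have leJd : jump d <=T A by apply: turing_le_trans (level_GL1 Cd) (join_ub led le0).
have [c [Cc ic lec leZc leJc]] := posner_robinson settd leJd leZ nZd.
have PB : tree_pair (join d c) by split; rewrite left_join ?right_join.
have [G1 G2] := tree_pair_GL1 PB.
have leB : join d c <=T A := join_ub led lec.
exists (join d c); split; first split=> //.
  rewrite /cylinder /= -[RHS]cyl; apply/eq_in_map => i; rewrite mem_iota /= => lt_i.
  rewrite -(join_halves X0) /join; have lt_half : i./2 < size s by lia.
  case: ifP => _.
    have lt_w : i./2 < size w by apply: leq_trans (size_node _ _ _ _); rewrite su.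
    by move: ic; rewrite eqw => /initialP -> //; move/initialP: iu => ->.
  have := congr1 (fun l => nth false l i./2) (agree' (size s) ltac:(lia)).
  by rewrite /= !nth_mkseq.
split; split=> //.
- by apply: turing_le_trans G1 (join_ub leB le0).
- by apply: turing_le_trans (join_ub leB le0) leZc.
- by apply: turing_le_trans (join_ub leB leZ) (turing_le_trans leJc G1).
Qed.

Theorem theorem1p2 :
  exists P : set real,
    [/\ Pi01_class P, special P, P `<=` GL1, join_property P
      & ~ pseudojump_inversion_property P] /\
    (forall s : seq bool,
       P `&` cylinder s !=set0 -> join_property (P `&` cylinder s)).
Proof.
exists tree_pair; split; last exact: tree_pair_local_join.
have all : tree_pair `&` cylinder [::] = tree_pair.
  by rewrite predeqE => X; split=> [[]|PX] //; split.
split; [exact: tree_pair_Pi01|exact: tree_pair_special|exact: tree_pair_GL1| |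
  exact: tree_pair_not_inversion].
by rewrite -all; apply: tree_pair_local_join; rewrite all; apply: tree_pair_nonempty.
Qed.
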